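(* Let $A$ be a $\mathbb{K}$-algebra over a field $\mathbb{K}$ and let $H_1$ and $H_2$ be (Schauenburg) Hopf algebroids over $A$. Suppose there exist a surjective bialgebroid morphism $\pi:H_2\to H_1$ and an injective bialgebroid morphism $\iota:H_1\to H_2$ with $\pi\iota=\mathrm{id}_{H_1}$. Then there exists a (braided) Hopf algebra $(B,\triangleright,\delta)$ in the center $Z({}_{H_1}\mathcal{M})$ of the monoidal category of left $H_1$-modules such that $H_2\cong B\mathbin{\rtimes\!\cdot}H_1$. Moreover, $B$ can be identified as the subspace of elements of the form $h-\iota\pi(h)$, for $h\in H_2$.
   Context: Write $A^{e}=A\otimes_{\mathbb{K}}A^{\mathrm{op}}$ with elements written $a\overline{b}$, $a\in A$, $\overline b\in A^{\mathrm{op}}$; $A$-bimodules are left $A^e$-modules ($a\overline b m=amb$). For an $A^e$-bimodule $D$, $|D$ denotes $D$ as an $A$-bimodule through its left $A^e$-action. A left $A$-bialgebroid is an $A^e$-bimodule $D$ with: a $\mathbb{K}$-algebra structure and an algebra map $\eta:A^e\to D$ inducing the bimodule structure by multiplication; $A$-bimodule maps $\Delta:|D\to|D\otimes_A|D$, $d\mapsto d_{(1)}\otimes_A d_{(2)}$, and $\epsilon:|D\to A$ making $|D$ a comonoid in $A$-bimodules, with $\Delta(dr\overline s)=d_{(1)}r\otimes_A d_{(2)}\overline s$ and $\epsilon(dr)=\epsilon(d\overline r)$ for $r,s\in A$; and $\Delta(dd')=d_{(1)}d'_{(1)}\otimes_A d_{(2)}d'_{(2)}$, $\Delta(1)=1\otimes_A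 1$, $\epsilon(1)=1$, $\epsilon(dd')=\epsilon(d\,\epsilon(d'))=\epsilon(d\,\overline{\epsilon(d')})$. It is a Schauenburg Hopf algebroid if the maps $\beta:D\otimes_{A^{\mathrm{op}}}D\to D\diamond D$, $d\otimes d'\mapsto d_{(1)}\diamond d_{(2)}d'$, and $\vartheta:D\odot D\to D\diamond D$, $d\odot d'\mapsto d_{(1)}d'\diamond d_{(2)}$, are invertible, where $D\otimes_{A^{\mathrm{op}}}D$, $D\odot D$, $D\diamond D$ are the quotients of $D\otimes_{\mathbb{K}}D$ by the relations $d\overline s\otimes d'=d\otimes\overline s d'$, $dr\otimes d'=d\otimes rd'$, $\overline s d\otimes d'=d\otimes sd'$ respectively. A bialgebroid morphism is an algebra map compatible with the maps $\eta$, $\Delta$ and $\epsilon$. For a bialgebroid $H$, ${}_{H}\mathcal{M}$ is monoidal: an $H$-module is an $A$-bimodule via $\eta$, the tensor product is $\otimes_A$ with action $h\triangleright(m\otimes n)=h_{(1)}m\otimes_A h_{(2)}n$, the unit is $A$. An object of the center $Z({}_{H}\mathcal{M})$ is an $H$-module $B$ with a natural isomorphism of $H$-modules $\tau_M:B\otimes_A M\to M\otimes_A B$ with $\tau_{M\otimes N}=(\mathrm{id}_M\otimes\tau_N)(\tau_M\otimes\mathrm{id}_N)$, $\tau_A=\mathrm{id}$; morphisms are $H$-linear maps compatible with the $\tau$'s; $(B,\tau)\otimes(B',\tau')=(B\otimes_A B',(\tau\otimes\mathrm{id})(\mathrm{id}\otimes\tau'))$; the braiding is $\tau_{B'}$.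 The associated coaction is $\delta(b)=b_{(-1)}\otimes_A b_{(0)}:=\tau_H(b\otimes_A 1_H)\in|H\otimes_A B$, and $\tau_M(b\otimes m)=b_{(-1)}m\otimes_A b_{(0)}$; $\triangleright$ denotes the $H$-action on $B$. A braided Hopf algebra in $Z({}_{H}\mathcal{M})$ is a bialgebra with antipode in this braided monoidal category. For such $B$ and a Hopf algebroid $H$, $B\mathbin{\rtimes\!\cdot}H$ denotes the Hopf algebroid on $B\otimes_A H$ (tensor product over the left $A$-action $a\cdot h=\eta(a)h$ on $H$) with $A^e$-bimodule structure $a_1\overline{a_2}(b\otimes h)a_3\overline{a_4}=a_1b\otimes\overline{a_2}ha_3\overline{a_4}$, unit $1_B\otimes 1_H$, product $(b\otimes h)(b'\otimes h')=b(h_{(1)}\triangleright b')\otimes h_{(2)}h'$, coproduct $\Delta(b\otimes h)=(b_{(1)}\otimes b_{(2)(-1)}h_{(1)})\otimes_A(b_{(2)(0)}\otimes h_{(2)})$ and counit $\epsilon(b\otimes h)=\epsilon_B(b)\epsilon_H(h)$. The isomorphism $\cong$ is one of Hopf algebroids over $A$.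
   Formalization: The printed description of B as elements h − ιπ(h) is false (for π = ι = id it gives 0, but B ≠ 0); it is replaced by elements h_+ ιπ(h_-), where h_+ ⊗ h_- = β^{-1}(h ⋄ 1). *)

(* Defs.v *)
From HB Require Import structures.
From mathcomp Require Import all_boot all_order all_algebra.
From mathcomp Require Import generic_quotient ring_quotient.
From mathcomp Require Import boolp.
From mathcomp Require Import freeg.

Set Implicit Arguments.
Unset Strict Implicit.
Unset Printing Implicit Defensive.

Import GRing.Theory.
Local Open Scope quotient_scope.
Local Open Scope ring_scope.

(** * Balanced tensor products

  [tens f g] is the quotient of the tensor product of [M] and [N] by the
  relations [f s m (x) n = m (x) g s n], [s : S].  It is built as a quotient of
  the free abelian group on [M * N].  Below, [S] is always a [K]-algebra whose
  scalars [k%:A] act through [f] and [g] as multiplication by [k], so that the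
  tensor product over [int] and the tensor product over [K] have the same
  quotient. *)

Section Tensor.
Variables (S : Type) (M N : zmodType) (f : S -> M -> M) (g : S -> N -> N).

Definition fpure (m : M) (n : N) : {freeg (M * N)} :=
  @freeg.Freeg int (M * N)%type [:: (1, (m, n))].

Inductive tens_rel : {freeg (M * N)} -> Prop :=
| TensRel0 : tens_rel 0
| TensRelB u v : tens_rel u -> tens_rel v -> tens_rel (u - v)
| TensRelDl m m' n :
    tens_rel (fpure (m + m') n - (fpure m n + fpure m' n))
| TensRelDr m n n' :
    tens_rel (fpure m (n + n') - (fpure m n + fpure m n'))
| TensRelBal s m n : tens_rel (fpure (f s m) n - fpure m (g s n)).

Definition tens_pred : {pred {freeg (M * N)}} := fun u => `[< tens_rel u >].

Lemma tens_pred_closed : zmod_closed tens_pred.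
Proof.
split; first by apply/asboolP; apply: TensRel0.
by move=> u v /asboolP hu /asboolP hv; apply/asboolP; apply: TensRelB.
Qed.
HB.instance Definition _ := GRing.isZmodClosed.Build _ tens_pred tens_pred_closed.

Definition tens : Type := Quotient.quot tens_pred.
HB.instance Definition _ := GRing.Zmodule.on tens.

End Tensor.

Section TensorTheory.
Variables (S : Type) (M N : zmodType) (f : S -> M -> M) (g : S -> N -> N).
Local Notation T := (tens f g).
Local Notation proj := (\pi_(Quotient.quot (@tens_pred S M N f g))).

Definition tpure (m : M) (n : N) : T := proj (fpure m n).

(* The element [\sum_i m_i (x) n_i] represented by a list of pairs. *)
Definition tsum (xs : seq (M * N)) : T := \sum_(x <- xs) tpure x.1 x.2.

Definition balanced (P : zmodType) (F : M -> N -> P) : Prop :=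
  [/\ forall n, {morph F^~ n : x y / x + y},
      forall m, {morph F m : x y / x + y}
    & forall s m n, F (f s m) n = F m (g s n)].

(* The map induced by [F] on the tensor product; it is defined on a chosen
   representative and is only meaningful when [F] is balanced, see [tliftE]. *)
Definition tlift (P : zmodType) (F : M -> N -> P) (x : T) : P :=
  freeg.fglift (fun p : M * N => F p.1 p.2 : zmodule P) (repr x).

Lemma pi_eqP (u v : {freeg (M * N)}) :
  proj u = proj v <-> tens_rel f g (u - v).
Proof.
split=> [/eqP|h].
  by rewrite -(@Quotient.idealrBE _ (@tens_pred S M N f g)) => /asboolP.
by apply/eqP; rewrite -(@Quotient.idealrBE _ (@tens_pred S M N f g)); apply/asboolP.
Qed.

Lemma piB (u v : {freeg (M * N)}) :
  proj (u - v) = proj u - proj v.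
Proof. exact: (raddfB proj). Qed.
Lemma piD (u v : {freeg (M * N)}) :
  proj (u + v) = proj u + proj v.
Proof. exact: (raddfD proj). Qed.

Lemma tpureDl m m' n : tpure (m + m') n = tpure m n + tpure m' n.
Proof. by rewrite /tpure -piD; apply/pi_eqP; apply: TensRelDl. Qed.
Lemma tpureDr m n n' : tpure m (n + n') = tpure m n + tpure m n'.
Proof. by rewrite /tpure -piD; apply/pi_eqP; apply: TensRelDr. Qed.
Lemma tpure_bal s m n : tpure (f s m) n = tpure m (g s n).
Proof. by apply/pi_eqP; apply: TensRelBal. Qed.

Lemma balanced_tpure : balanced tpure.
Proof.
by split=> [n m m'|m n n'|s m n]; rewrite (tpureDl, tpureDr, tpure_bal).
Qed.

Lemma tpureNl m n : tpure (- m) n = - tpure m n.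
Proof.
have t0 : tpure 0 n = 0 by apply: (addIr (tpure 0 n)); rewrite -tpureDl !add0r.
by apply: (addIr (tpure m n)); rewrite -tpureDl !addNr.
Qed.

Lemma tens_sumP (x : T) : exists xs, x = tsum xs.
Proof.
elim/quotW: x => u.
rewrite -(freeg.Freeg_enum u); elim: (freeg.fgenum u) => [|[k [m n]] s [xs IH]].
  exists [::]; rewrite /tsum big_nil freeg.freeg_nil.
  exact: (raddf0 proj).
rewrite -cat1s freeg.freeg_cat piD IH.
suff [ys ->] : exists ys, proj (freeg.Freeg [:: (k, (m, n))]) = tsum ys.
  by exists (ys ++ xs); rewrite /tsum big_cat.
have -> : freeg.Freeg [:: (k, (m, n))] = fpure m n *~ k.
  by rewrite /fpure freeg.freeg_mulz intz.
have piM j (w : {freeg (M * N)}) : proj (w *~ j) = proj w *~ j.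
  exact: (raddfMz proj).
have nseqE j p : tsum (nseq j p) = tpure p.1 p.2 *+ j.
  by rewrite /tsum; elim: j => [|j IHj]; rewrite /= (big_nil, big_cons) // IHj mulrS.
rewrite piM -/(tpure m n); case: k => j.
  by exists (nseq j (m, n)); rewrite nseqE.
by exists (nseq j.+1 (- m, n)); rewrite nseqE NegzE mulrNz tpureNl mulNrn.
Qed.

Lemma tens_ind (Pr : T -> Prop) :
  Pr 0 -> (forall m n x, Pr x -> Pr (tpure m n + x)) -> forall x, Pr x.
Proof.
move=> P0 PD x; have [xs ->] := tens_sumP x; rewrite /tsum.
by elim: xs => [|y xs IH]; rewrite (big_nil, big_cons) //; apply: PD.
Qed.

Section Lift.
Variables (P : zmodType) (F : M -> N -> P).
Hypothesis balF : balanced F.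

Let FZ := fun p : M * N => F p.1 p.2 : zmodule P.

Lemma fglift_rel u : tens_rel f g u -> freeg.fglift FZ u = 0.
Proof.
have lB := @freeg.lift_is_additive _ _ _ FZ.
have [l0 lD] : freeg.fglift FZ 0 = 0 /\
    {morph freeg.fglift FZ : u v / u + v >-> u + v}.
  have l0 : freeg.fglift FZ 0 = 0 by have := lB 0 0; rewrite !subrr.
  have lN w : freeg.fglift FZ (- w) = - freeg.fglift FZ w.
    by rewrite -[- w]sub0r lB l0 sub0r.
  by split=> // v w; rewrite -{1}[w]opprK lB lN opprK.
have lp m n : freeg.fglift FZ (fpure m n) = F m n.
  by rewrite freeg.liftU scale1r.
case: balF => Fl Fr Fs.
elim=> [||m m' n|m n n'|s m n]; rewrite ?lB ?lD ?lp //.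
- by move=> v w _ hv _ hw; rewrite lB hv hw subrr.
- by rewrite Fl subrr.
- by rewrite Fr subrr.
- by rewrite Fs subrr.
Qed.

Lemma tlift_pi u : tlift F (proj u) = freeg.fglift FZ u.
Proof.
have lB := @freeg.lift_is_additive _ _ _ FZ.
apply/eqP; rewrite -subr_eq0; apply/eqP; rewrite /tlift -lB.
by apply: fglift_rel; apply/pi_eqP; rewrite reprK.
Qed.

Lemma tliftE m n : tlift F (tpure m n) = F m n.
Proof. by rewrite tlift_pi freeg.liftU scale1r. Qed.

Lemma tliftB : {morph tlift F : x y / x - y}.
Proof.
move=> x y; rewrite -[x]reprK -[y]reprK -piB !tlift_pi.
exact: (@freeg.lift_is_additive _ _ _ FZ).
Qed.
Lemma tlift0 : tlift F 0 = 0.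
Proof. by have := tliftB 0 0; rewrite !subrr. Qed.
Lemma tliftD : {morph tlift F : x y / x + y}.
Proof.
have tliftN y : tlift F (- y) = - tlift F y.
  by rewrite -[- y]sub0r tliftB tlift0 sub0r.
by move=> x y; rewrite -{1}[y]opprK tliftB tliftN opprK.
Qed.

Lemma tlift_tsum xs : tlift F (tsum xs) = \sum_(x <- xs) F x.1 x.2.
Proof.
rewrite /tsum; elim: xs => [|x xs IH]; rewrite ?big_nil ?tlift0 //.
by rewrite !big_cons tliftD tliftE IH.
Qed.
End Lift.

End TensorTheory.

Arguments tpure {S M N f g} m n.
Arguments tsum {S M N f g} xs.

Section TensorMaps.

Definition tmap (S S' : Type) (M N M' N' : zmodType)
    (f : S -> M -> M) (g : S -> N -> N) (f' : S' -> M' -> M') (g' : S' -> N' -> N')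
    (u : M -> M') (v : N -> N') : tens f g -> tens f' g' :=
  tlift (fun m n => tpure (u m) (v n)).

(* The associator and its inverse, on iterated tensor products. *)
Variables (S1 S2 S3 S4 : Type) (M N P : zmodType).
Variables (f1 : S1 -> M -> M) (g1 : S1 -> N -> N).
Variables (f2 : S2 -> tens f1 g1 -> tens f1 g1) (g2 : S2 -> P -> P).
Variables (f3 : S3 -> N -> N) (g3 : S3 -> P -> P).
Variables (f4 : S4 -> M -> M) (g4 : S4 -> tens f3 g3 -> tens f3 g3).

Definition tassoc : tens f2 g2 -> tens f4 g4 :=
  tlift (fun x p =>
    tlift (fun m n => tpure m (tpure n p)) x).

Definition tassocV : tens f4 g4 -> tens f2 g2 :=
  tlift (fun m x =>
    tlift (fun n p => tpure (tpure m n) p) x).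

End TensorMaps.

Arguments tmap {S S' M N M' N' f g f' g'} u v x.
Arguments tassoc {S1 S2 S3 S4 M N P f1 g1 f2 g2 f3 g3 f4 g4} x.
Arguments tassocV {S1 S2 S3 S4 M N P f1 g1 f2 g2 f3 g3 f4 g4} x.

(** * Bialgebroids and Hopf algebroids *)

(* A [K]-algebra with an algebra map [eta] from [A (x) A^op].  The map is given
   by its restrictions [src a = eta (a (x) 1)] and [tgt b = eta (1 (x) b)], two
   algebra maps with commuting images, so that [eta (a (x) b) = src a * tgt b].
   The induced [A^e]-bimodule structure is
   [a1 \bar{a2} d a3 \bar{a4} = src a1 * tgt a2 * d * src a3 * tgt a4]. *)
Record aering (K : fieldType) (A : algType K) := AeRing {
  ae_alg :> algType K;
  src : {lrmorphism A -> ae_alg};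
  tgt : {rmorphism A^c -> ae_alg};
  tgtZ : forall (k : K) (a : A), tgt (k *: a) = k *: tgt a;
  src_tgtC : forall a b : A, src a * tgt b = tgt b * src a }.

Arguments src {K A} D : rename.
Arguments tgt {K A} D : rename.

(* A module [M] over an [A^e]-ring [D] is an [A]-bimodule with left action [src]
   and right action [tgt]; this is the tensor product over [A]. *)
Definition atens (K : fieldType) (A : algType K) (D : aering A)
    (M N : lmodType D) : Type :=
  tens (fun (a : A) (m : M) => tgt D a *: m) (fun (a : A) (n : N) => src D a *: n).

Section AeRing.
Variables (K : fieldType) (A : algType K) (D : aering A).

(* [|D (x)_A |D], which is also the quotient [D <> D]. *)
Definition dtens : Type :=
  tens (fun (a : A) (d : D) => tgt D a * d) (fun (a : A) (d : D) => src D a * d).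
HB.instance Definition _ := GRing.Zmodule.on dtens.

Definition dpure (d d' : D) : dtens := tpure d d'.

(* [(|D (x)_A |D) (x)_A |D] and [|D (x)_A (|D (x)_A |D)] *)
Definition dtens3l : Type :=
  tens (fun (a : A) (x : dtens) => tmap id ( *%R (tgt D a)) x : dtens)
       (fun (a : A) (d : D) => src D a * d).
Definition dtens3r : Type :=
  tens (fun (a : A) (d : D) => tgt D a * d)
       (fun (a : A) (x : dtens) => tmap ( *%R (src D a)) id x : dtens).
HB.instance Definition _ := GRing.Zmodule.on dtens3l.
HB.instance Definition _ := GRing.Zmodule.on dtens3r.

End AeRing.

Record bialgebroid (K : fieldType) (A : algType K) := Bialgebroid {
  bgd_ae :> aering A;
  cop : {additive bgd_ae -> dtens bgd_ae};
  eps : {additive bgd_ae -> A};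
  cop_bimod : forall (a b : A) d,
    cop (src bgd_ae a * tgt bgd_ae b * d)
      = tmap ( *%R (src bgd_ae a)) ( *%R (tgt bgd_ae b)) (cop d);
  eps_bimod : forall (a b : A) d,
    eps (src bgd_ae a * tgt bgd_ae b * d) = a * eps d * b;
  copA : forall d,
    tassoc (tmap cop id (cop d) : dtens3l bgd_ae) = tmap id cop (cop d) :> dtens3r bgd_ae;
  cop_epsl : forall d, tlift (fun d1 d2 => src bgd_ae (eps d1) * d2) (cop d) = d;
  cop_epsr : forall d, tlift (fun d1 d2 => tgt bgd_ae (eps d2) * d1) (cop d) = d;
  cop_mulr : forall d (r s : A),
    cop (d * src bgd_ae r * tgt bgd_ae s)
      = tmap (fun x => x * src bgd_ae r) (fun y => y * tgt bgd_ae s) (cop d);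
  eps_mulr : forall d (r : A), eps (d * src bgd_ae r) = eps (d * tgt bgd_ae r);
  (* The componentwise product is not defined on all of [|D (x)_A |D]: the axiom
     includes that, on the image of [cop], it does not depend on the choice of
     representatives (the Takeuchi condition, see [takeuchi]). *)
  copM : forall d d' xs ys, cop d = tsum xs -> cop d' = tsum ys ->
    cop (d * d') = \sum_(x <- xs) \sum_(y <- ys) dpure (x.1 * y.1) (x.2 * y.2);
  cop1 : cop 1 = dpure 1 1;
  eps1 : eps 1 = 1;
  epsM_src : forall d d', eps (d * d') = eps (d * src bgd_ae (eps d'));
  epsM_tgt : forall d d', eps (d * d') = eps (d * tgt bgd_ae (eps d')) }.

Arguments cop {K A} D : rename.
Arguments eps {K A} D : rename.

Section HopfAlgebroid.
Variables (K : fieldType) (A : algType K) (D : bialgebroid A).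

(* [D (x)_{A^op} D] and [D (.) D] *)
Definition dtens_op : Type :=
  tens (fun (a : A) (d : D) => d * tgt D a) (fun (a : A) (d : D) => tgt D a * d).
Definition dtens_odot : Type :=
  tens (fun (a : A) (d : D) => d * src D a) (fun (a : A) (d : D) => src D a * d).
HB.instance Definition _ := GRing.Zmodule.on dtens_op.
HB.instance Definition _ := GRing.Zmodule.on dtens_odot.

Definition beta : dtens_op -> dtens D :=
  tlift (fun d d' => tmap id (fun y => y * d') (cop D d) : dtens D).
Definition vartheta : dtens_odot -> dtens D :=
  tlift (fun d d' => tmap (fun y => y * d') id (cop D d) : dtens D).

End HopfAlgebroid.

Arguments beta {K A} D.
Arguments vartheta {K A} D.

Record hopf_algebroid (K : fieldType) (A : algType K) := HopfAlgebroid {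
  hopf_bgd :> bialgebroid A;
  beta_bij : bijective (beta hopf_bgd);
  vartheta_bij : bijective (vartheta hopf_bgd) }.

Record bgd_hom (K : fieldType) (A : algType K) (D D' : bialgebroid A) := BgdHom {
  bgd_fun :> {lrmorphism D -> D'};
  bgd_src : forall a : A, bgd_fun (src D a) = src D' a;
  bgd_tgt : forall a : A, bgd_fun (tgt D a) = tgt D' a;
  bgd_cop : forall d, cop D' (bgd_fun d) = tmap bgd_fun bgd_fun (cop D d);
  bgd_eps : forall d, eps D' (bgd_fun d) = eps D d }.

Record bgd_iso (K : fieldType) (A : algType K) (D D' : bialgebroid A) := BgdIso {
  iso_hom :> bgd_hom D D';
  iso_inv : bgd_hom D' D;
  iso_homK : cancel iso_hom iso_inv;
  iso_invK : cancel iso_inv iso_hom }.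

(** * The monoidal category of modules over a bialgebroid *)

Section Modules.
Variables (K : fieldType) (A : algType K) (H : bialgebroid A).

Lemma takeuchi h xs (a : A) : cop H h = tsum xs ->
  \sum_(x <- xs) dpure (x.1 * tgt H a) x.2
    = \sum_(x <- xs) dpure x.1 (x.2 * src H a) :> dtens H.
Proof.
move=> hxs.
have e1 : cop H 1 = tsum [:: (1, 1)] by rewrite cop1 /tsum big_seq1.
have e2 : cop H 1 = tsum [:: (1, 1); (tgt H a, 1); (-1, src H a)].
  rewrite e1 /tsum !big_cons !big_nil /= !addr0 -[LHS]addr0; congr (_ + _).
  have -> : tpure (tgt H a) 1 = tpure 1 (src H a) :> dtens H.
    by have := @tpure_bal A H H (fun a d => tgt H a * d) (fun a d => src H a * d) a 1 1;
       rewrite !mulr1.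
  by rewrite tpureNl addrN.
have E := etrans (esym (copM hxs e1)) (copM hxs e2).
have {}E : \sum_(x <- xs) dpure (x.1 * 1) (x.2 * 1) = \sum_(x <- xs)
    (dpure (x.1 * 1) (x.2 * 1)
      + (dpure (x.1 * tgt H a) (x.2 * 1) + dpure (x.1 * -1) (x.2 * src H a)))
    :> dtens H.
  apply: etrans (etrans E _); apply: eq_bigr => x _; first by rewrite big_seq1.
  by rewrite !big_cons big_nil addr0.
move: E; rewrite big_split /= -{1}[X in X = _]addr0 => /addrI/esym.
rewrite big_split /=.
under eq_bigr do rewrite mulr1.
under [X in _ + X]eq_bigr do rewrite mulrN1 /dpure tpureNl.
by rewrite sumrN => /eqP; rewrite subr_eq0 => /eqP.
Qed.

Lemma cop_sum h : exists xs, cop H h = tsum xs.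
Proof. exact: tens_sumP. Qed.

Definition mtens (M N : lmodType H) : Type := atens M N.

Section MTens.
Variables M N : lmodType H.
HB.instance Definition _ := GRing.Zmodule.on (mtens M N).

(* [h |> (m (x) n) = h_(1) m (x) h_(2) n] *)
Definition mtens_act (h : H) (x : mtens M N) : mtens M N :=
  tlift (fun m n =>
    tlift (fun h1 h2 => tpure (h1 *: m) (h2 *: n) : mtens M N) (cop H h)) x.

Lemma mtens_act_bal1 (m : M) (n : N) :
  balanced (fun (a : A) (d : H) => tgt H a * d) (fun (a : A) (d : H) => src H a * d)
    (fun h1 h2 => tpure (h1 *: m) (h2 *: n) : mtens M N).
Proof.
split=> [h2 x y|h1 x y|a x y].
- by rewrite scalerDl tpureDl.
- by rewrite scalerDl tpureDr.
- by rewrite -!scalerA -tpure_bal.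
Qed.

Lemma mtens_act_bal h :
  balanced (fun (a : A) (m : M) => tgt H a *: m) (fun (a : A) (n : N) => src H a *: n)
    (fun m n =>
      tlift (fun h1 h2 => tpure (h1 *: m) (h2 *: n) : mtens M N) (cop H h)).
Proof.
have [xs hxs] := cop_sum h.
have E m n : tlift (fun h1 h2 => tpure (h1 *: m) (h2 *: n) : mtens M N) (cop H h)
    = \sum_(x <- xs) tpure (x.1 *: m) (x.2 *: n).
  by rewrite hxs (tlift_tsum (mtens_act_bal1 m n)).
split=> [n m m'|m n n'|a m n]; rewrite !E.
- by rewrite -big_split /=; apply: eq_bigr => x _; rewrite scalerDr tpureDl.
- by rewrite -big_split /=; apply: eq_bigr => x _; rewrite scalerDr tpureDr.
have := congr1 (tlift (fun h1 h2 => tpure (h1 *: m) (h2 *: n) : mtens M N))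
  (takeuchi a hxs).
have := tlift_tsum (mtens_act_bal1 m n); rewrite /tsum => L.
have := L [seq (x.1 * tgt H a, x.2) | x <- xs]; rewrite !big_map /= => ->.
have := L [seq (x.1, x.2 * src H a) | x <- xs]; rewrite !big_map /= => ->.
under eq_bigr do rewrite -scalerA; under [in RHS]eq_bigr do rewrite -scalerA.
by [].
Qed.

Lemma mtens_act_sum h xs (m : M) (n : N) : cop H h = tsum xs ->
  mtens_act h (tpure m n) = \sum_(x <- xs) tpure (x.1 *: m) (x.2 *: n).
Proof.
move=> hxs; rewrite /mtens_act (tliftE (mtens_act_bal h)) hxs.
by rewrite (tlift_tsum (mtens_act_bal1 m n)).
Qed.

Lemma mtens_actDr h : {morph mtens_act h : x y / x + y}.
Proof. by move=> x y; rewrite /mtens_act (tliftD (mtens_act_bal h)). Qed.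

Lemma mtens_act0 h : mtens_act h 0 = 0.
Proof. exact: tlift0 (mtens_act_bal h). Qed.

Lemma mtens_actA h h' x : mtens_act h (mtens_act h' x) = mtens_act (h * h') x.
Proof.
elim/tens_ind: x => [|m n x IH]; first by rewrite !mtens_act0.
rewrite !mtens_actDr IH; congr (_ + _).
have [xs hxs] := cop_sum h; have [ys hys] := cop_sum h'.
have hxy : cop H (h * h') =
    tsum [seq (x.1 * y.1, x.2 * y.2) | x <- xs, y <- ys].
  by rewrite (copM hxs hys) /tsum big_allpairs_dep.
rewrite (mtens_act_sum _ _ hys) (mtens_act_sum _ _ hxy).
rewrite (big_morph _ (mtens_actDr h) (mtens_act0 h)) big_allpairs_dep /=.
rewrite exchange_big /=; apply: eq_bigr => y _.
rewrite (mtens_act_sum _ _ hxs); apply: eq_bigr => z _.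
by rewrite !scalerA.
Qed.

Lemma mtens_act1 x : mtens_act 1 x = x.
Proof.
elim/tens_ind: x => [|m n x IH]; first by rewrite mtens_act0.
rewrite mtens_actDr IH; congr (_ + _).
rewrite (@mtens_act_sum _ [:: (1, 1)]) ?cop1 /tsum ?big_seq1 //=.
by rewrite !scale1r.
Qed.

Lemma mtens_actDl x : {morph mtens_act^~ x : h h' / h + h'}.
Proof.
move=> h h'; elim/tens_ind: x => [|m n x IH]; first by rewrite !mtens_act0 addr0.
rewrite !mtens_actDr IH.
have [xs hxs] := cop_sum h; have [ys hys] := cop_sum h'.
have hxy : cop H (h + h') = tsum (xs ++ ys).
  by rewrite raddfD /= hxs hys /tsum big_cat.
rewrite (mtens_act_sum _ _ hys) (mtens_act_sum _ _ hxs) (mtens_act_sum _ _ hxy).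
by rewrite big_cat /= addrACA.
Qed.

HB.instance Definition _ := GRing.Zmodule_isLmodule.Build H (mtens M N)
  mtens_actA mtens_act1 mtens_actDr mtens_actDl.

Definition mpure (m : M) (n : N) : mtens M N := tpure m n.

End MTens.

(* The unit object: [A] with [h |> a = epsilon (h a)]. *)
Definition munit of bialgebroid A : Type := A.
HB.instance Definition _ := GRing.Zmodule.on (munit H).

Definition munit_act (h : H) (a : (munit H)) : munit H := eps H (h * src H (a : A)).

Lemma munit_actA h h' a : munit_act h (munit_act h' a) = munit_act (h * h') a.
Proof. by rewrite /munit_act -mulrA [RHS]epsM_src. Qed.
Lemma munit_act1 a : munit_act 1 a = a.
Proof.
have := @eps_bimod K A H a 1 1.
by rewrite !rmorph1 eps1 !mulr1 /munit_act mul1r.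
Qed.
Lemma munit_actDr h : {morph munit_act h : a a' / a + a'}.
Proof. by move=> a a'; rewrite /munit_act !raddfD /= mulrDr raddfD. Qed.
Lemma munit_actDl a : {morph munit_act^~ a : h h' / h + h'}.
Proof. by move=> h h'; rewrite /munit_act mulrDl raddfD. Qed.

HB.instance Definition _ := GRing.Zmodule_isLmodule.Build H (munit H)
  munit_actA munit_act1 munit_actDr munit_actDl.

Definition mmap (M N M' N' : lmodType H) (u : M -> M') (v : N -> N') :
  mtens M N -> mtens M' N' := tmap u v.
Definition massoc (M N P : lmodType H) :
  mtens (mtens M N) P -> mtens M (mtens N P) := tassoc.
Definition massocV (M N P : lmodType H) :
  mtens M (mtens N P) -> mtens (mtens M N) P := tassocV.

Definition munit1 : munit H := (1 : A).

(* The unit constraints and their inverses. *)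
Definition mlunit (M : lmodType H) : mtens (munit H) M -> M :=
  tlift (fun a m => src H (a : A) *: m).
Definition mrunit (M : lmodType H) : mtens M (munit H) -> M :=
  tlift (fun m a => tgt H (a : A) *: m).
Definition mlunitV (M : lmodType H) (m : M) : mtens (munit H) M := mpure munit1 m.
Definition mrunitV (M : lmodType H) (m : M) : mtens M (munit H) := mpure m munit1.

End Modules.

Arguments munit1 {K A} H.

(** * The center and braided Hopf algebras *)

(* An object of the center; [cen_unit] is [tau_A = id] up to the unit constraints
   and [cen_tens] is the hexagon [tau_(M (x) N) = (id (x) tau_N) (tau_M (x) id)]
   up to associators. *)
Record center_obj (K : fieldType) (A : algType K) (H : bialgebroid A) := CenterObj {
  cen_mod :> lmodType H;
  cen_br : forall M : lmodType H, {linear mtens cen_mod M -> mtens M cen_mod};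
  cen_bij : forall M, bijective (cen_br M);
  cen_nat : forall (M N : lmodType H) (f : {linear M -> N}) x,
    cen_br N (mmap id f x) = mmap f id (cen_br M x);
  cen_tens : forall (M N : lmodType H) (x : mtens (mtens cen_mod M) N),
    massoc (cen_br (mtens M N) (massoc x))
      = mmap id (cen_br N) (massoc (mmap (cen_br M) id x));
  cen_unit : forall x, mlunit (cen_br (munit H) x) = mrunit x }.

Arguments cen_br {K A H} B M : rename.

Section Center.
Variables (K : fieldType) (A : algType K) (H : bialgebroid A).

Definition half_braiding (B : lmodType H) : Type :=
  forall M : lmodType H, mtens B M -> mtens M B.

(* [(tau (x) id) (id (x) tau')], the half-braiding of a tensor product. *)
Definition hb_tens (B B' : lmodType H) (tau : half_braiding B)
    (tau' : half_braiding B') : half_braiding (mtens B B') :=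
  fun M x =>
    massoc (mmap (tau M) id (massocV (mmap id (tau' M) (massoc x)))).

Definition hb_unit : half_braiding (munit H) := fun M x => mrunitV (mlunit x).

(* Compatibility of a map with half-braidings: for [H]-linear maps, being a
   morphism of the center. *)
Definition hb_compat (B B' : lmodType H) (tau : half_braiding B)
    (tau' : half_braiding B') (f : B -> B') : Prop :=
  forall (M : lmodType H) (x : mtens B M),
    tau' M (mmap f id x) = mmap id f (tau M x).

(* [id (x) tau_B (x) id] on [(B (x) B) (x) (B (x) B)]. *)
Definition mid_braid (B : lmodType H) (tau : half_braiding B)
    (x : mtens (mtens B B) (mtens B B)) : mtens (mtens B B) (mtens B B) :=
  massocV (mmap id (fun y : mtens B (mtens B B) =>
    massoc (mmap (tau B) id (massocV y))) (massoc x)).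

(* The element [b (x) h] of [B (x)_A H]. *)
Definition hpure (B : lmodType H) (b : B) (h : H) : mtens B H^o :=
  mpure b (h : H^o).

(* The coaction [delta b = tau_H (b (x) 1_H)]. *)
Definition coaction (B : center_obj H) (b : B) : mtens H^o B :=
  cen_br B H^o (hpure b 1).

End Center.

(* A bialgebra with antipode in the center; the structure maps are morphisms of
   the center. *)
Record braided_hopf (K : fieldType) (A : algType K) (H : bialgebroid A) :=
  BraidedHopf {
  bh_obj :> center_obj H;
  bh_mul : {linear mtens bh_obj bh_obj -> bh_obj};
  bh_unit : {linear munit H -> bh_obj};
  bh_cop : {linear bh_obj -> mtens bh_obj bh_obj};
  bh_eps : {linear bh_obj -> munit H};
  bh_anti : {linear bh_obj -> bh_obj};
  bh_mul_br :
    hb_compat (hb_tens (cen_br bh_obj) (cen_br bh_obj)) (cen_br bh_obj) bh_mul;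
  bh_unit_br : hb_compat (@hb_unit K A H) (cen_br bh_obj) bh_unit;
  bh_cop_br :
    hb_compat (cen_br bh_obj) (hb_tens (cen_br bh_obj) (cen_br bh_obj)) bh_cop;
  bh_eps_br : hb_compat (cen_br bh_obj) (@hb_unit K A H) bh_eps;
  bh_anti_br : hb_compat (cen_br bh_obj) (cen_br bh_obj) bh_anti;
  bh_mulA : forall x, bh_mul (mmap bh_mul id x) = bh_mul (mmap id bh_mul (massoc x));
  bh_mul1l : forall b, bh_mul (mmap bh_unit id (mlunitV b)) = b;
  bh_mul1r : forall b, bh_mul (mmap id bh_unit (mrunitV b)) = b;
  bh_copA : forall b, massoc (mmap bh_cop id (bh_cop b)) = mmap id bh_cop (bh_cop b);
  bh_cop1l : forall b, mlunit (mmap bh_eps id (bh_cop b)) = b;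
  bh_cop1r : forall b, mrunit (mmap id bh_eps (bh_cop b)) = b;
  bh_cop_mul : forall x,
    bh_cop (bh_mul x)
      = mmap bh_mul bh_mul (mid_braid (cen_br bh_obj) (mmap bh_cop bh_cop x));
  bh_cop_unit : forall a, bh_cop (bh_unit a) = mmap bh_unit bh_unit (mlunitV a);
  bh_eps_mul : forall x, bh_eps (bh_mul x) = mlunit (mmap bh_eps bh_eps x);
  bh_eps_unit : forall a, bh_eps (bh_unit a) = a;
  bh_antil : forall b, bh_mul (mmap bh_anti id (bh_cop b)) = bh_unit (bh_eps b);
  bh_antir : forall b, bh_mul (mmap id bh_anti (bh_cop b)) = bh_unit (bh_eps b) }.

Arguments bh_mul {K A H} B : rename.
Arguments bh_unit {K A H} B : rename.
Arguments bh_cop {K A H} B : rename.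
Arguments bh_eps {K A H} B : rename.

(* The Hopf algebroid [B >< . H] on [B (x)_A H]: [bp_inj] identifies
   [B (x)_A H] with the underlying abelian group of [bp_hopf], and the remaining
   fields give all structure maps on the elements [b (x) h].  Together they
   determine the Hopf algebroid structure transported to [B (x)_A H].
   In [bp_cop] the sum over the coaction has to be taken inside the one over
   [cop H h]: only its total is balanced in [h_(1)] and [h_(2)]. *)
Record biproduct (K : fieldType) (A : algType K) (H : hopf_algebroid A)
    (B : braided_hopf H) := Biproduct {
  bp_hopf :> hopf_algebroid A;
  bp_inj : {additive mtens B H^o -> bp_hopf};
  bp_bij : bijective bp_inj;
  bp_bimod : forall (a1 a2 a3 a4 : A) (b : B) (h : H),
    src bp_hopf a1 * tgt bp_hopf a2 * bp_inj (hpure b h)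
        * src bp_hopf a3 * tgt bp_hopf a4
      = bp_inj (hpure (src H a1 *: b) (tgt H a2 * h * src H a3 * tgt H a4));
  bp_one : 1 = bp_inj (hpure (bh_unit B (munit1 H)) 1);
  bp_mul : forall (b b' : B) (h h' : H),
    bp_inj (hpure b h) * bp_inj (hpure b' h')
      = bp_inj (tlift (fun h1 h2 =>
          hpure (bh_mul B (mpure b (h1 *: b'))) (h2 * h')) (cop H h));
  bp_cop : forall (b : B) (h : H),
    cop bp_hopf (bp_inj (hpure b h))
      = tlift (fun b1 b2 => tlift (fun h1 h2 => tlift (fun k b0 =>
            dpure (bp_inj (hpure b1 (k * h1))) (bp_inj (hpure b0 h2)))
          (coaction b2)) (cop H h)) (bh_cop B b);
  bp_eps : forall (b : B) (h : H),
    eps bp_hopf (bp_inj (hpure b h)) = (bh_eps B b : A) * eps H h }.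

(* With [beta^-1 (h <> 1) = h_+ (x) h_-], the graph of the map
   [h |-> h_+ * iota (pi h_-)]. *)
Definition split_proj (K : fieldType) (A : algType K) (H1 H2 : bialgebroid A)
    (pi : bgd_hom H2 H1) (iota : bgd_hom H1 H2) (h x : H2) : Prop :=
  exists2 z : dtens_op H2, beta H2 z = dpure h 1
    & x = tlift (fun d d' => d * iota (pi d')) z.

(* Main.v *)
(** The coinvariants [B] of [pi] are the image of [prj d = d_+ * iota (pi d_-)], and
    [b (x) h |-> b * iota h] is a bijection from [B (x)_A H1] to [H2], with inverse
    [d |-> prj d_(1) (x) pi d_(2)]; so [H2] itself serves as the biproduct and all
    structure of [B] is read off from that of [H2].  The action is
    [h |> b = prj (iota h * b)], the coproduct [prj b_(1) (x) prj b_(2)], and the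
    half-braiding [b (x) m |-> pi b_(1) m (x) prj b_(2)].  More generally
    [B (x)_A M] is [H2 (x)_{H1} M], on which the action of [H1] is left multiplication,
    which makes the maps involved visibly linear.  The half-braiding is inverted by
    means of [vartheta], and the antipode of [B] is [b |-> iota (pi b_+) * b_-].

    There is no antipode on [H2] to compute with.  Instead, since [beta] is onto, two
    additive functions of [d (x) y] agree as soon as they agree on the elements
    [x_(1) (x) x_(2) y], where [d_+ (x) d_-] cancels. *)

Require Import Defs.
From HB Require Import structures.
From mathcomp Require Import all_boot all_order all_algebra.
From mathcomp Require Import boolp.

Set Implicit Arguments.
Unset Strict Implicit.
Unset Printing Implicit Defensive.

Import GRing.Theory.
Local Open Scope ring_scope.

(** * Balanced maps and Sweedler sums *)

Section Balanced.
Variables (K : fieldType) (A : algType K).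

(** A product of legs such as u * x (x) v * y is no function on D (x)_A D, so every rewriting of a
    Sweedler sum carries a proof that its summand is balanced. Two facts supply most of these
    proofs: the Takeuchi condition, for left multiplication by a whole coproduct, and the
    commutation of coinvariants with the image of [tgt], for left multiplication by a coinvariant.
    The two legs may live in different rings because the second one is often pushed to H1 by [pi].

    An identity in d alone says nothing about the elements x_(1) (x) x_(2) y. It is therefore
    multiplied on the right by a free factor y, checked on those elements, and specialized to y = 1.

    The coproduct, counit and antipode of B come from maps on all of H2 that factor through
    [prj]. *)

Definition balA (D E : aering A) (P : zmodType) (F : D -> E -> P) : Prop :=
  balanced (fun (a : A) (d : D) => tgt D a * d) (fun (a : A) (e : E) => src E a * e) F.

Definition balA3 (D E E' : aering A) (P : zmodType) (F : D -> E -> E' -> P) : Prop :=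
  (forall z, balA (fun x y => F x y z)) /\ (forall x, balA (F x)).

End Balanced.

(** Stated for bare additive functions, since lifts, multiplications and tensoring with a fixed
    element occur below without a bundled structure. Cancellation yields f 0 = 0. *)
Lemma morphD_sum (M P : zmodType) (f : M -> P) (I : Type) (r : seq I) (F : I -> M)
    (fD : {morph f : x y / x + y}) :
  f (\sum_(i <- r) F i) = \sum_(i <- r) f (F i).
Proof.
apply: (big_morph f fD).
by apply: (addIr (f 0)); rewrite -fD !add0r.
Qed.

Lemma tens_eq (S : Type) (M N P : zmodType) (f : S -> M -> M) (g : S -> N -> N)
    (F G : tens f g -> P) :
  {morph F : x y / x + y} -> {morph G : x y / x + y} ->
  (forall m n, F (tpure m n) = G (tpure m n)) -> F =1 G.
Proof.
move=> FD GD FG x; have [xs ->] := tens_sumP x.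
rewrite /tsum !morphD_sum //; exact: eq_bigr.
Qed.

(** * Associativity of iterated balanced tensor products *)

Section Associator.
Variables (S1 S2 : Type) (M N P : zmodType).
Variables (f1 : S1 -> M -> M) (g1 : S1 -> N -> N) (f3 : S2 -> N -> N) (g3 : S2 -> P -> P).
Variables (f2 : S2 -> tens f1 g1 -> tens f1 g1) (g4 : S1 -> tens f3 g3 -> tens f3 g3).
Hypothesis f2D : forall s, {morph f2 s : x y / x + y}.
Hypothesis g4D : forall s, {morph g4 s : x y / x + y}.
Hypothesis f2E : forall s m n, f2 s (tpure m n) = tpure m (f3 s n).
Hypothesis g4E : forall s n p, g4 s (tpure n p) = tpure (g1 s n) p.

Local Notation Tl := (tens f2 g3).
Local Notation Tr := (tens f1 g4).

(** The outer actions [f2] and [g4] are known only through their values on pure tensors, so that the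
    section serves both bialgebroids, where they are [tmap]s, and modules, where they are scalings
    through a coproduct. *)
Lemma tassoc_bal1 p : balanced f1 g1 (fun m n => tpure m (tpure n p) : Tr).
Proof.
split=> [n m m'|m n n'|s m n].
- by rewrite tpureDl.
- by rewrite tpureDl tpureDr.
- by rewrite tpure_bal g4E.
Qed.

Lemma tassoc_bal :
  balanced f2 g3 (fun x p => tlift (fun m n => tpure m (tpure n p) : Tr) x).
Proof.
split=> [p x x'|x p p'|s x p].
- exact: (tliftD (tassoc_bal1 p)).
- have [xs ->] := tens_sumP x; rewrite !(tlift_tsum (tassoc_bal1 _)) -big_split /=.
  by apply: eq_bigr => y _; rewrite !tpureDr.
- move: x; apply: tens_eq.
  + by move=> x y; rewrite f2D (tliftD (tassoc_bal1 p)).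
  + exact: (tliftD (tassoc_bal1 _)).
  + by move=> m n; rewrite f2E !(tliftE (tassoc_bal1 _)) tpure_bal.
Qed.

Lemma tassocD : {morph (tassoc : Tl -> Tr) : x y / x + y}.
Proof. exact: (tliftD tassoc_bal). Qed.

Lemma tassocE m n p : (tassoc : Tl -> Tr) (tpure (tpure m n) p) = tpure m (tpure n p).
Proof. by rewrite /tassoc (tliftE tassoc_bal) (tliftE (tassoc_bal1 p)). Qed.

Lemma tassocV_bal1 m : balanced f3 g3 (fun n p => tpure (tpure m n) p : Tl).
Proof.
split=> [n x x'|x n n'|s x p].
- by rewrite tpureDr tpureDl.
- by rewrite tpureDr.
- by rewrite -tpure_bal f2E.
Qed.

Lemma tassocV_bal :
  balanced f1 g4 (fun m x => tlift (fun n p => tpure (tpure m n) p : Tl) x).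
Proof.
split=> [x m m'|m x x'|s m x].
- have [xs ->] := tens_sumP x; rewrite !(tlift_tsum (tassocV_bal1 _)) -big_split /=.
  by apply: eq_bigr => y _; rewrite !tpureDl.
- exact: (tliftD (tassocV_bal1 m)).
- move: x; apply: tens_eq.
  + exact: (tliftD (tassocV_bal1 _)).
  + by move=> x y; rewrite g4D (tliftD (tassocV_bal1 m)).
  + by move=> n p; rewrite g4E !(tliftE (tassocV_bal1 _)) tpure_bal.
Qed.

Lemma tassocVD : {morph (tassocV : Tr -> Tl) : x y / x + y}.
Proof. exact: (tliftD tassocV_bal). Qed.

Lemma tassocVE m n p : (tassocV : Tr -> Tl) (tpure m (tpure n p)) = tpure (tpure m n) p.
Proof. by rewrite /tassocV (tliftE tassocV_bal) (tliftE (tassocV_bal1 m)). Qed.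

End Associator.

Lemma morphD_comp (M N P : zmodType) (g : N -> P) (f : M -> N) :
  {morph g : x y / x + y} -> {morph f : x y / x + y} ->
  {morph (fun x => g (f x)) : x y / x + y}.
Proof. by move=> gD fD x y; rewrite fD gD. Qed.

(** * Sweedler sums and their calculus *)

Section Sweedler.
Variables (K : fieldType) (A : algType K) (D : bialgebroid A).

Definition cop_rep (d : D) : seq (D * D) := sval (cid (cop_sum d)).

Lemma cop_repE d : cop D d = tsum (cop_rep d).
Proof. exact: (svalP (cid (cop_sum d))). Qed.

(* The Sweedler sum [F d_(1) d_(2)]; it depends on the choice of a representative
   of [cop D d] unless [F] is balanced, see [swE]. *)
Definition sw (P : zmodType) (d : D) (F : D -> D -> P) : P :=
  \sum_(x <- cop_rep d) F x.1 x.2.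

Section SwTheory.
Variable P : zmodType.
Implicit Types (F G : D -> D -> P) (d : D).

Lemma eq_sw d F G : (forall x y, F x y = G x y) -> sw d F = sw d G.
Proof. by move=> FG; apply: eq_bigr => -[x y] _ /=. Qed.

Lemma swD d F G : sw d (fun x y => F x y + G x y) = sw d F + sw d G.
Proof. exact: big_split. Qed.

Lemma sw_morph (Q : zmodType) (f : P -> Q) d F : {morph f : x y / x + y} ->
  f (sw d F) = sw d (fun x y => f (F x y)).
Proof. exact: morphD_sum. Qed.

Lemma swE d F : balA F -> sw d F = tlift F (cop D d).
Proof. by move=> bF; rewrite cop_repE (tlift_tsum bF). Qed.

Lemma sw_tsum d xs F : balA F -> cop D d = tsum xs ->
  sw d F = \sum_(x <- xs) F x.1 x.2.
Proof. by move=> bF h; rewrite swE // h (tlift_tsum bF). Qed.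

Lemma sw_argD d d' F : balA F -> sw (d + d') F = sw d F + sw d' F.
Proof. by move=> bF; rewrite !swE // raddfD /= (tliftD bF). Qed.

Lemma sw_sum I (r : seq I) (g : I -> D) F : balA F ->
  sw (\sum_(i <- r) g i) F = \sum_(i <- r) sw (g i) F.
Proof.
by move=> bF; apply: (morphD_sum _ (f := fun d => sw d F)) => x y; apply: sw_argD.
Qed.

Lemma sw1 F : balA F -> sw 1 F = F 1 1.
Proof. by move=> bF; rewrite swE // cop1 (tliftE bF). Qed.

Lemma sw_mul d d' F : balA F ->
  sw (d * d') F = sw d (fun x y => sw d' (fun x' y' => F (x * x') (y * y'))).
Proof.
move=> bF; rewrite (@sw_tsum _ [seq (x.1 * y.1, x.2 * y.2)
   | x <- cop_rep d, y <- cop_rep d']) //.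
  by rewrite big_allpairs_dep.
by rewrite (copM (cop_repE d) (cop_repE d')) /tsum big_allpairs_dep.
Qed.

End SwTheory.
End Sweedler.

Section SweedlerRules.
Variables (K : fieldType) (A : algType K).
Implicit Types D E : bialgebroid A.

(** No balancedness is required: both sums run over representatives fixed once and for all. *)
Lemma sw_exchange D E (P : zmodType) (d : D) (e : E) (F : D -> D -> E -> E -> P) :
  sw d (fun x y => sw e (F x y)) = sw e (fun z w => sw d (fun x y => F x y z w)).
Proof. exact: exchange_big. Qed.

Lemma eps_src D (a : A) (d : D) : eps D (src D a * d) = a * eps D d.
Proof. by have := eps_bimod a 1 d; rewrite rmorph1 !mulr1. Qed.

Lemma eps_tgt D (a : A) (d : D) : eps D (tgt D a * d) = eps D d * a.
Proof. by have := eps_bimod 1 a d; rewrite rmorph1 !mul1r. Qed.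

(** Turns a formula for [cop] written with [tmap] into a rule for Sweedler sums; [sw_bimod],
    [sw_mulr] and [sw_hom] are instances. *)
Lemma sw_tmap D E (P : zmodType) (u v : D -> E) (d : D) (e : E) (F : E -> E -> P) :
    {morph u : x y / x + y} -> {morph v : x y / x + y} ->
    (forall a x, u (tgt D a * x) = tgt E a * u x) ->
    (forall a x, v (src D a * x) = src E a * v x) ->
    cop E e = tmap u v (cop D d) -> balA F ->
  sw e F = sw d (fun x y => F (u x) (v y)).
Proof.
move=> uD vD ut vs he bF; case: (bF) => Fl Fr Fs.
rewrite (swE _ bF) he cop_repE /tmap tlift_tsum.
  rewrite (morphD_sum _ (f := tlift F)); last exact: tliftD bF.
  by apply: eq_bigr => -[x y] _; rewrite (tliftE bF).
split=> [y x x'|x y y'|a x y].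
- by rewrite uD tpureDl.
- by rewrite vD tpureDr.
- rewrite ut vs.
  exact: (@tpure_bal _ _ _ (fun a d => tgt E a * d) (fun a d => src E a * d)).
Qed.

Lemma dtens_bal D a (x y : D) :
  tpure (tgt D a * x) y = tpure x (src D a * y) :> dtens D.
Proof.
exact: (@tpure_bal _ _ _ (fun a d => tgt D a * d) (fun a d => src D a * d)).
Qed.

Lemma balA_tgt D a : balA (fun x y => tpure x (tgt D a * y) : dtens D).
Proof.
split=> [n m m'|m n n'|b m n].
- by rewrite tpureDl.
- by rewrite mulrDr tpureDr.
- by rewrite dtens_bal !mulrA src_tgtC.
Qed.

Lemma balA_src D a : balA (fun x y => tpure (src D a * x) y : dtens D).
Proof.
split=> [n m m'|m n n'|b m n].
- by rewrite mulrDr tpureDl.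
- by rewrite tpureDr.
- by rewrite mulrA src_tgtC -mulrA dtens_bal.
Qed.

Lemma dtens_srcE D a (x y : D) :
  tmap ( *%R (src D a)) id (tpure x y : dtens D) = tpure (src D a * x) y :> dtens D.
Proof. exact: (tliftE (balA_src D a)). Qed.

Lemma dtens_tgtE D a (x y : D) :
  tmap id ( *%R (tgt D a)) (tpure x y : dtens D) = tpure x (tgt D a * y) :> dtens D.
Proof. exact: (tliftE (balA_tgt D a)). Qed.

Lemma cop_srcl D a d : cop D (src D a * d) = tmap ( *%R (src D a)) id (cop D d).
Proof.
have := cop_bimod a 1 d; rewrite rmorph1 mulr1 => ->.
by congr tmap; apply/funext=> x; rewrite mul1r.
Qed.

Lemma cop_tgtl D a d : cop D (tgt D a * d) = tmap id ( *%R (tgt D a)) (cop D d).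
Proof.
have := cop_bimod 1 a d; rewrite rmorph1 mul1r => ->.
by congr tmap; apply/funext=> x; rewrite mul1r.
Qed.

Section OneBialgebroid.
Variables (D : bialgebroid A) (P : zmodType).
Implicit Types (d : D) (a : A) (F : D -> D -> P).

Lemma sw_bimod a b d F : balA F ->
  sw (src D a * tgt D b * d) F = sw d (fun x y => F (src D a * x) (tgt D b * y)).
Proof.
move=> bF; apply: sw_tmap (cop_bimod a b d) bF; try exact: mulrDr.
- by move=> c x; rewrite !mulrA src_tgtC.
- by move=> c x; rewrite !mulrA src_tgtC.
Qed.

Lemma sw_srcl a d F : balA F ->
  sw (src D a * d) F = sw d (fun x y => F (src D a * x) y).
Proof.
move=> bF; have := sw_bimod a 1 d bF; rewrite rmorph1 mulr1 => ->.
by apply: eq_sw => x y; rewrite mul1r.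
Qed.

Lemma sw_tgtl a d F : balA F ->
  sw (tgt D a * d) F = sw d (fun x y => F x (tgt D a * y)).
Proof.
move=> bF; have := sw_bimod 1 a d bF; rewrite rmorph1 mul1r => ->.
by apply: eq_sw => x y; rewrite mul1r.
Qed.

Lemma sw_mulr a b d F : balA F ->
  sw (d * src D a * tgt D b) F = sw d (fun x y => F (x * src D a) (y * tgt D b)).
Proof.
move=> bF; apply: sw_tmap (cop_mulr d a b) bF; try by move=> x y; rewrite mulrDl.
- by move=> c x; rewrite !mulrA.
- by move=> c x; rewrite !mulrA.
Qed.

Lemma sw_srcr a d F : balA F ->
  sw (d * src D a) F = sw d (fun x y => F (x * src D a) y).
Proof.
move=> bF; have := sw_mulr a 1 d bF; rewrite rmorph1 mulr1 => ->.
by apply: eq_sw => x y; rewrite mulr1.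
Qed.

Lemma sw_tgtr a d F : balA F ->
  sw (d * tgt D a) F = sw d (fun x y => F x (y * tgt D a)).
Proof.
move=> bF; have := sw_mulr 1 a d bF; rewrite rmorph1 mulr1 => ->.
by apply: eq_sw => x y; rewrite mulr1.
Qed.

Lemma sw_takeuchi a d F : balA F ->
  sw d (fun x y => F (x * tgt D a) y) = sw d (fun x y => F x (y * src D a)).
Proof.
move=> bF; have := congr1 (tlift F) (takeuchi a (cop_repE d)).
rewrite !(morphD_sum _ _ (tliftD bF)).
by under eq_bigr do rewrite (tliftE bF); under [in RHS]eq_bigr do rewrite (tliftE bF).
Qed.

Lemma sw_epsl d (F : D -> P) : {morph F : x y / x + y} ->
  sw d (fun x y => F (src D (eps D x) * y)) = F d.
Proof.
move=> FD; rewrite -[in RHS](cop_epsl d) -swE ?(sw_morph _ _ FD) //.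
split=> [y x x'|x y y'|a x y].
- by rewrite !raddfD mulrDl.
- by rewrite mulrDr.
- by rewrite eps_tgt rmorphM mulrA.
Qed.

Lemma sw_epsr d (F : D -> P) : {morph F : x y / x + y} ->
  sw d (fun x y => F (tgt D (eps D y) * x)) = F d.
Proof.
move=> FD; rewrite -[in RHS](cop_epsr d) -swE ?(sw_morph _ _ FD) //.
split=> [y x x'|x y y'|a x y].
- by rewrite mulrDr.
- by rewrite !raddfD mulrDl.
- by rewrite eps_src (rmorphM (tgt D) (eps D y) a) mulrA.
Qed.

(** A function balanced at both junctions lifts in two stages to the iterated tensor product, where
    [copA] can be applied; both sides are then evaluated on pure tensors. *)
Lemma sw_coassoc d (F : D -> D -> D -> P) : balA3 F ->
  sw d (fun x y => sw x (fun x1 x2 => F x1 x2 y))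
    = sw d (fun x y => sw y (fun y1 y2 => F x y1 y2)).
Proof.
move=> [F12 F23].
have srcD a : {morph (fun w : dtens D => tmap ( *%R (src D a)) id w : dtens D) :
    x y / x + y} := tliftD (balA_src D a).
have tgtD a : {morph (fun w : dtens D => tmap id ( *%R (tgt D a)) w : dtens D) :
    x y / x + y} := tliftD (balA_tgt D a).
pose T3 : zmodType := dtens3r D.
pose as3 (w : dtens3l D) : T3 := tassoc w.
have as3D : {morph as3 : x y / x + y}.
  exact: (tassocD tgtD (dtens_tgtE (D:=D)) (dtens_srcE (D:=D))).
have as3E x y z : as3 (tpure (tpure x y : dtens D) z)
    = tpure x (tpure y z : dtens D).
  exact: (tassocE tgtD (dtens_tgtE (D:=D)) (dtens_srcE (D:=D))).
have bL : balanced (fun (a : A) (d : D) => tgt D a * d)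
    (fun (a : A) (w : dtens D) => tmap ( *%R (src D a)) id w : dtens D)
    (fun x w => tlift (F x) w).
  split=> [w x x'|x w w'|a x w].
  - have [xs ->] := tens_sumP w; rewrite !(tlift_tsum (F23 _)) -big_split /=.
    by apply: eq_bigr => y _; case: (F12 y.2) => ->.
  - exact: (tliftD (F23 x)).
  - move: w; apply: tens_eq.
    + exact: (tliftD (F23 _)).
    + by move=> w w'; rewrite srcD (tliftD (F23 x)).
    + move=> y z; rewrite dtens_srcE !(tliftE (F23 _)).
      by case: (F12 z) => _ _ ->.
pose L (w : T3) : P := tlift (fun x w => tlift (F x) w) w.
have LD : {morph L : x y / x + y} := tliftD bL.
have LE x w : L (tpure x w) = tlift (F x) w := tliftE bL x w.
have bl : balA (fun x y => tpure (cop D x) y : dtens3l D).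
  split=> [z w w'|w z z'|a w z].
  - by rewrite raddfD tpureDl.
  - by rewrite tpureDr.
  - rewrite cop_tgtl; exact: (@tpure_bal _ _ _
      (fun a (w : dtens D) => tmap id ( *%R (tgt D a)) w : dtens D)
      (fun a d => src D a * d)).
have br : balA (fun x y => tpure x (cop D y) : T3).
  split=> [z w w'|w z z'|a w z].
  - by rewrite tpureDl.
  - by rewrite raddfD tpureDr.
  - rewrite cop_srcl; exact: (@tpure_bal _ _ _ (fun a d => tgt D a * d)
      (fun a (w : dtens D) => tmap ( *%R (src D a)) id w : dtens D)).
have E : as3 (sw d (fun x y => tpure (cop D x) y)) = sw d (fun x y => tpure x (cop D y)).
  by rewrite (swE _ bl) (swE _ br); apply: copA.
have := congr1 L E; rewrite (sw_morph _ _ as3D) !(sw_morph _ _ LD) => {}E.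
transitivity (sw d (fun x y => L (tpure x (cop D y)))); last first.
  by apply: eq_sw => x y; rewrite (swE _ (F23 x)) -LE.
rewrite -E; apply: eq_sw => x y; rewrite [in RHS](cop_repE x) /tsum.
rewrite (morphD_sum _ _ (f := fun w => as3 (tpure w y))); last first.
  by move=> w w'; rewrite tpureDl as3D.
rewrite (morphD_sum _ _ LD) /sw; apply: eq_bigr => z _.
by rewrite as3E LE (tliftE (F23 _)).
Qed.

End OneBialgebroid.

Lemma balA_mulrr D E (P : zmodType) (F : D -> E -> P) x y : balA F ->
  balA (fun u v => F (u * x) (v * y)).
Proof.
case=> Fl Fr Fs; split=> [n m m'|m n n'|a m n].
- by rewrite mulrDl Fl.
- by rewrite mulrDl Fr.
- by rewrite -!mulrA Fs.
Qed.

(** The Takeuchi condition in the form used most: left multiplication by d_(1) (x) d_(2) respects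
    the relations of the tensor product over A, although u (x) v alone does not. *)
Lemma balA_sw_mull D (P : zmodType) (d : D) (F : D -> D -> P) : balA F ->
  balA (fun x y => sw d (fun u v => F (u * x) (v * y))).
Proof.
move=> bF; case: (bF) => Fl Fr Fs; split=> [n m m'|m n n'|a m n].
- by rewrite -swD; apply: eq_sw => u v; rewrite mulrDr Fl.
- by rewrite -swD; apply: eq_sw => u v; rewrite mulrDr Fr.
under eq_sw do rewrite mulrA; under [RHS]eq_sw do rewrite mulrA.
exact: sw_takeuchi (balA_mulrr _ _ bF).
Qed.

Lemma sw_src D (P : zmodType) a (F : D -> D -> P) : balA F ->
  sw (src D a) F = F (src D a) 1.
Proof.
move=> bF; rewrite -[in LHS](mul1r (src D a)) sw_srcr // sw1 ?mul1r //.
have := balA_mulrr (src D a) 1 bF; congr balA.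
by do 2!(apply/funext => ?); rewrite mulr1.
Qed.

Lemma sw_tgt D (P : zmodType) a (F : D -> D -> P) : balA F ->
  sw (tgt D a) F = F 1 (tgt D a).
Proof.
move=> bF; rewrite -[in LHS](mul1r (tgt D a)) sw_tgtr // sw1 ?mul1r //.
have := balA_mulrr 1 (tgt D a) bF; congr balA.
by do 2!(apply/funext => ?); rewrite mulr1.
Qed.

Lemma sw_sw D E (P : zmodType) (d : E) (g : E -> E -> D) (F : D -> D -> P) : balA F ->
  sw (sw d g) F = sw d (fun x y => sw (g x y) F).
Proof. by move=> bF; rewrite {2}/sw (sw_sum _ _ bF). Qed.

(** Nothing commutes but the two sums. With d' outermost, the inner sum is balanced in the legs of
    d' by [balA_sw_mull], so that [sw_hom] applies when d' is the image of a morphism. *)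
Lemma sw_mulC D (P : zmodType) (d d' : D) (F : D -> D -> P) : balA F ->
  sw (d * d') F = sw d' (fun x y => sw d (fun u v => F (u * x) (v * y))).
Proof. by move=> bF; rewrite sw_mul // sw_exchange. Qed.

Lemma sw_hom D E (f : bgd_hom D E) (P : zmodType) (d : D) (F : E -> E -> P) : balA F ->
  sw (f d) F = sw d (fun x y => F (f x) (f y)).
Proof.
move=> bF; apply: sw_tmap (bgd_cop f d) bF; try exact: raddfD.
- by move=> a x; rewrite rmorphM /= bgd_tgt.
- by move=> a x; rewrite rmorphM /= bgd_src.
Qed.

End SweedlerRules.

(** * The canonical maps of a Hopf algebroid *)

Section Generation.
Variables (K : fieldType) (A : algType K) (D : hopf_algebroid A).

Lemma balA_mulr (y : D) : balA (fun x1 x2 : D => tpure x1 (x2 * y) : dtens D).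
Proof.
split=> [n m m'|m n n'|a m n].
- by rewrite tpureDl.
- by rewrite mulrDl tpureDr.
- by rewrite dtens_bal mulrA.
Qed.

Lemma balA_mull (y : D) : balA (fun x1 x2 : D => tpure (x1 * y) x2 : dtens D).
Proof.
split=> [n m m'|m n n'|a m n].
- by rewrite mulrDl tpureDl.
- by rewrite tpureDr.
- by rewrite -mulrA dtens_bal.
Qed.

Definition op_balanced (P : zmodType) (F : D -> D -> P) : Prop :=
  balanced (fun (a : A) (d : D) => d * tgt D a) (fun (a : A) (d : D) => tgt D a * d) F.

Definition odot_balanced (P : zmodType) (F : D -> D -> P) : Prop :=
  balanced (fun (a : A) (d : D) => d * src D a) (fun (a : A) (d : D) => src D a * d) F.

Lemma beta_balanced :
  op_balanced (fun x y => tmap id (fun z => z * y) (cop D x) : dtens D).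
Proof.
have E x y : tmap id (fun z => z * y) (cop D x)
    = sw x (fun x1 x2 => tpure x1 (x2 * y) : dtens D).
  by rewrite swE //; apply: balA_mulr.
split=> [n m m'|m n n'|a m n]; rewrite !E.
- by rewrite sw_argD //; apply: balA_mulr.
- by rewrite -swD; apply: eq_sw => x y; rewrite mulrDr tpureDr.
- rewrite sw_tgtr; last exact: balA_mulr.
  by apply: eq_sw => x y; rewrite mulrA.
Qed.

Lemma vartheta_balanced :
  odot_balanced (fun x y => tmap (fun z => z * y) id (cop D x) : dtens D).
Proof.
have E x y : tmap (fun z => z * y) id (cop D x)
    = sw x (fun x1 x2 => tpure (x1 * y) x2 : dtens D).
  by rewrite swE //; apply: balA_mull.
split=> [n m m'|m n n'|a m n]; rewrite !E.
- by rewrite sw_argD //; apply: balA_mull.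
- by rewrite -swD; apply: eq_sw => x y; rewrite mulrDr tpureDl.
- rewrite sw_srcr; last exact: balA_mull.
  by apply: eq_sw => x y; rewrite mulrA.
Qed.

Lemma betaD : {morph beta D : x y / x + y}.
Proof. exact: (tliftD beta_balanced). Qed.

Lemma varthetaD : {morph vartheta D : x y / x + y}.
Proof. exact: (tliftD vartheta_balanced). Qed.

Lemma betaE (x y : D) : beta D (tpure x y) = sw x (fun x1 x2 => tpure x1 (x2 * y)).
Proof.
rewrite (swE _ (balA_mulr y)); exact: (tliftE beta_balanced x y).
Qed.

Lemma varthetaE (x y : D) :
  vartheta D (tpure x y) = sw x (fun x1 x2 => tpure (x1 * y) x2).
Proof.
rewrite (swE _ (balA_mull y)); exact: (tliftE vartheta_balanced x y).
Qed.

(* As [beta] is onto, [D (x)_A D] is spanned by the elements [x_(1) (x) x_(2) y];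
   this is what stands in for the antipode identities in the proofs below. *)
Lemma beta_gen (P : zmodType) (F G : D -> D -> P) : balA F -> balA G ->
  (forall x y, sw x (fun x1 x2 => F x1 (x2 * y)) = sw x (fun x1 x2 => G x1 (x2 * y))) ->
  forall x y, F x y = G x y.
Proof.
move=> bF bG FG x y; have [g _ gK] := beta_bij D.
rewrite -(tliftE bF) -(tliftE bG) -[tpure x y]gK.
move: (g _) => z; move: z.
apply: (tens_eq (F := fun z => tlift F (beta D z)) (G := fun z => tlift G (beta D z))).
- by move=> z z'; rewrite betaD (tliftD bF).
- by move=> z z'; rewrite betaD (tliftD bG).
move=> u v; rewrite betaE (sw_morph _ _ (tliftD bF)) (sw_morph _ _ (tliftD bG)).
under eq_sw do rewrite (tliftE bF); rewrite FG.
by apply: eq_sw => u1 u2; rewrite (tliftE bG).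
Qed.

Lemma vartheta_gen (P : zmodType) (F G : D -> D -> P) : balA F -> balA G ->
  (forall x y, sw x (fun x1 x2 => F (x1 * y) x2) = sw x (fun x1 x2 => G (x1 * y) x2)) ->
  forall x y, F x y = G x y.
Proof.
move=> bF bG FG x y; have [g _ gK] := vartheta_bij D.
rewrite -(tliftE bF) -(tliftE bG) -[tpure x y]gK.
move: (g _) => z; move: z.
apply: (tens_eq (F := fun z => tlift F (vartheta D z))
  (G := fun z => tlift G (vartheta D z))).
- by move=> z z'; rewrite varthetaD (tliftD bF).
- by move=> z z'; rewrite varthetaD (tliftD bG).
move=> u v; rewrite varthetaE (sw_morph _ _ (tliftD bF)) (sw_morph _ _ (tliftD bG)).
under eq_sw do rewrite (tliftE bF); rewrite FG.
by apply: eq_sw => u1 u2; rewrite (tliftE bG).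
Qed.

Lemma beta_inv_ex : exists g, cancel g (beta D).
Proof. by have [g _ gK] := beta_bij D; exists g. Qed.

Lemma vartheta_inv_ex : exists g, cancel g (vartheta D).
Proof. by have [g _ gK] := vartheta_bij D; exists g. Qed.

Definition beta_inv : dtens D -> dtens_op D := sval (cid beta_inv_ex).

Definition vartheta_inv : dtens D -> dtens_odot D := sval (cid vartheta_inv_ex).

Lemma beta_invK : cancel beta_inv (beta D).
Proof. exact: (svalP (cid beta_inv_ex)). Qed.

Lemma vartheta_invK : cancel vartheta_inv (vartheta D).
Proof. exact: (svalP (cid vartheta_inv_ex)). Qed.

Lemma betaK : cancel (beta D) beta_inv.
Proof. by move=> z; apply: (bij_inj (beta_bij D)); rewrite beta_invK. Qed.

Lemma varthetaK : cancel (vartheta D) vartheta_inv.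
Proof. by move=> z; apply: (bij_inj (vartheta_bij D)); rewrite vartheta_invK. Qed.

Lemma beta_invD : {morph beta_inv : x y / x + y}.
Proof.
by move=> x y; apply: (bij_inj (beta_bij D)); rewrite betaD !beta_invK.
Qed.

Lemma vartheta_invD : {morph vartheta_inv : x y / x + y}.
Proof.
by move=> x y; apply: (bij_inj (vartheta_bij D)); rewrite varthetaD !vartheta_invK.
Qed.

(* [d_+ (x) d_- y |-> F d_+ (d_- y)] *)
Definition beta_ext (P : zmodType) (F : D -> D -> P) (d y : D) : P :=
  tlift F (beta_inv (dpure d y)).

Definition vartheta_ext (P : zmodType) (F : D -> D -> P) (d y : D) : P :=
  tlift F (vartheta_inv (dpure d y)).

Section Extension.
Variables (P : zmodType) (F : D -> D -> P).

Lemma beta_ext_bal : op_balanced F -> balA (beta_ext F).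
Proof.
move=> bF; rewrite /beta_ext /dpure; split=> [n m m'|m n n'|a m n].
- by rewrite tpureDl beta_invD (tliftD bF).
- by rewrite tpureDr beta_invD (tliftD bF).
- by rewrite dtens_bal.
Qed.

Lemma vartheta_ext_bal : odot_balanced F -> balA (vartheta_ext F).
Proof.
move=> bF; rewrite /vartheta_ext /dpure; split=> [n m m'|m n n'|a m n].
- by rewrite tpureDl vartheta_invD (tliftD bF).
- by rewrite tpureDr vartheta_invD (tliftD bF).
- by rewrite dtens_bal.
Qed.

(** The law d_(1)+ (x) d_(1)- d_(2) y = d (x) y of the translation map, seen through F. *)
Lemma beta_extE x y : op_balanced F ->
  sw x (fun x1 x2 => beta_ext F x1 (x2 * y)) = F x y.
Proof.
move=> bF; rewrite -[RHS](tliftE bF) -[tpure x y]betaK betaE.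
by rewrite (sw_morph _ _ beta_invD) (sw_morph _ _ (tliftD bF)).
Qed.

Lemma vartheta_extE x y : odot_balanced F ->
  sw x (fun x1 x2 => vartheta_ext F (x1 * y) x2) = F x y.
Proof.
move=> bF; rewrite -[RHS](tliftE bF) -[tpure x y]varthetaK varthetaE.
by rewrite (sw_morph _ _ vartheta_invD) (sw_morph _ _ (tliftD bF)).
Qed.

End Extension.
End Generation.

(* The convolution product of [gamma] with the "inverse" [alpha \o S] of [alpha],
   [d |-> gamma d_+ * alpha d_-]; no antipode [S] is available in general. *)
Section ConvolutionQuotient.
Variables (K : fieldType) (A : algType K) (D : hopf_algebroid A) (E : bialgebroid A).
Variables (gamma alpha : bgd_hom D E).

Lemma hom_mul_op_balanced : op_balanced (fun x y => gamma x * alpha y).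
Proof.
split=> [n m m'|m n n'|a m n].
- by rewrite raddfD mulrDl.
- by rewrite raddfD mulrDr.
- by rewrite !rmorphM /= !bgd_tgt mulrA.
Qed.
Let opb := hom_mul_op_balanced.

Definition convS (d : D) : E := beta_ext (fun x y => gamma x * alpha y) d 1.

Lemma convS_ext d y : beta_ext (fun x y => gamma x * alpha y) d y = convS d * alpha y.
Proof.
(* Generalizing the 1 gives an identity in two variables with y as a parameter, which is the shape
   [beta_gen] needs. *)
rewrite /convS -[in LHS](mul1r y); move: d 1.
have bE := beta_ext_bal opb; case: (bE) => El Er Es.
apply: beta_gen.
- split=> [n m m'|m n n'|a m n]; first by rewrite El.
  + by rewrite mulrDl Er.
  + by rewrite Es mulrA.
- split=> [n m m'|m n n'|a m n]; first by rewrite El mulrDl.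
  + by rewrite Er mulrDl.
  + by rewrite Es.
move=> x z; under eq_sw do rewrite -mulrA.
rewrite (beta_extE _ _ opb).
rewrite -(sw_morph (f := fun w => w * alpha y)); last by move=> ? ?; rewrite mulrDl.
by rewrite (beta_extE _ _ opb) rmorphM mulrA.
Qed.

Lemma convSD : {morph convS : x y / x + y}.
Proof. by move=> x y; rewrite /convS; case: (beta_ext_bal opb) => ->. Qed.

Lemma convS_tgt a d : convS (tgt D a * d) = convS d * src E a.
Proof.
rewrite -(bgd_src alpha) -convS_ext /convS; case: (beta_ext_bal opb) => _ _ ->.
by rewrite mulr1.
Qed.

(** The defining property of [convS]: with y free, it gives the value of convS u * alpha v on every
    generator x_(1) (x) x_(2) y. *)
Lemma convS_sw d y : sw d (fun x1 x2 => convS x1 * alpha (x2 * y)) = gamma d * alpha y.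
Proof. by under eq_sw do rewrite -convS_ext; rewrite (beta_extE _ _ opb). Qed.

Lemma convS_sw1 d : sw d (fun x1 x2 => convS x1 * alpha x2) = gamma d.
Proof.
have := convS_sw d 1; rewrite rmorph1 mulr1 => <-.
by apply: eq_sw => x y; rewrite mulr1.
Qed.

Lemma convS_bal : balA (fun d y => convS d * alpha y).
Proof.
split=> [n m m'|m n n'|a m n].
- by rewrite convSD mulrDl.
- by rewrite raddfD mulrDr.
- by rewrite convS_tgt rmorphM /= bgd_src mulrA.
Qed.

Lemma convS_src a d : convS (src D a * d) = src E a * convS d.
Proof.
suff S y : convS (src D a * d) * alpha y = src E a * convS d * alpha y.
  by have := S 1; rewrite rmorph1 !mulr1.
case: convS_bal => bl br bs; move: d y; apply: beta_gen.
- split=> [n m m'|m n n'|b m n].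
  + by rewrite mulrDr bl.
  + by rewrite br.
  + by rewrite mulrA src_tgtC -mulrA bs.
- split=> [n m m'|m n n'|b m n]; rewrite -!mulrA.
  + by rewrite bl mulrDr.
  + by rewrite br mulrDr.
  + by rewrite bs.
move=> x y.
rewrite -(sw_srcl a x (F := fun x1 x2 => convS x1 * alpha (x2 * y))); last first.
  split=> [n m m'|m n n'|b m n]; first by rewrite bl.
    by rewrite mulrDl br.
  by rewrite bs mulrA.
rewrite convS_sw rmorphM /= bgd_src -mulrA -convS_sw.
rewrite (sw_morph (f := fun w => src E a * w)); last by move=> ? ?; rewrite mulrDr.
by apply: eq_sw => u v; rewrite mulrA.
Qed.

(** The coproduct of tgt a * x carries the factor on its second leg, where [alpha] turns it into a
    factor to the right of [convS]. Hence left multiplication of a first leg by a value of [convS]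
    is compatible with the tensor product over A. *)
Lemma convS_tgtC a d : tgt E a * convS d = convS d * tgt E a.
Proof.
suff S y : tgt E a * convS d * alpha y = convS d * tgt E a * alpha y.
  by have := S 1; rewrite rmorph1 !mulr1.
case: convS_bal => bl br bs; move: d y; apply: beta_gen.
- split=> [n m m'|m n n'|b m n]; rewrite -!mulrA.
  + by rewrite bl mulrDr.
  + by rewrite br mulrDr.
  + by rewrite bs.
- split=> [n m m'|m n n'|b m n].
  + by rewrite convSD !mulrDl.
  + by rewrite raddfD mulrDr.
  + rewrite convS_tgt rmorphM /= bgd_src.
    by rewrite -!mulrA; congr (_ * _); rewrite !mulrA src_tgtC.
move=> x y.
transitivity (sw (tgt D a * x) (fun x1 x2 => convS x1 * alpha (x2 * y))).
  rewrite convS_sw rmorphM /= bgd_tgt -mulrA -convS_sw.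
  rewrite (sw_morph (f := fun w => tgt E a * w)); last by move=> ? ?; rewrite mulrDr.
  by apply: eq_sw => u v; rewrite mulrA.
rewrite sw_tgtl; last first.
  split=> [n m m'|m n n'|b m n]; first by rewrite bl.
    by rewrite mulrDl br.
  by rewrite bs mulrA.
by apply: eq_sw => u v; rewrite !rmorphM /= bgd_tgt !mulrA.
Qed.

Variables (H : bialgebroid A) (rho : bgd_hom E H).
Hypothesis rho_eq : forall d, rho (alpha d) = rho (gamma d).

Lemma balA_hom_r (P : zmodType) (F : E -> H -> P) : balA F -> balA (fun u v => F u (rho v)).
Proof.
case=> Fl Fr Fs; split=> [n m m'|m n n'|a m n]; rewrite ?raddfD ?Fl ?Fr //.
by rewrite Fs rmorphM /= bgd_src.
Qed.

(** Values of [convS] are coinvariant under [rho]: their coproduct c_(1) (x) rho c_(2) is c (x) 1.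
    After multiplication by alpha y, both sides become on generators the coproduct of gamma x *
    alpha y, by coassociativity and the agreement of [rho \o alpha] with [rho \o gamma]. *)
Lemma convS_coinv (P : zmodType) (F : E -> H -> P) d : balA F ->
  sw (convS d) (fun u v => F u (rho v)) = F (convS d) 1.
Proof.
move=> bF; case: (bF) => Fl Fr Fs; pose Phi u v := F u (rho v).
have bPhi : balA Phi := balA_hom_r bF.
suff S y : sw (convS d * alpha y) Phi
         = sw (alpha y) (fun u v => F (convS d * u) (rho v)).
  have := S 1; rewrite rmorph1 mulr1 => ->; rewrite sw1.
    by rewrite mulr1 rmorph1.
  split=> [n m m'|m n n'|a m n].
  + by rewrite mulrDr Fl.
  + by rewrite raddfD Fr.
  + by rewrite mulrA -convS_tgtC -mulrA Fs rmorphM /= bgd_src.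
have bF2 m : balA (fun u v => F (convS m * u) (rho v)).
  split=> [n u u'|u n n'|a u n].
  + by rewrite mulrDr Fl.
  + by rewrite raddfD Fr.
  + by rewrite mulrA -convS_tgtC -mulrA Fs rmorphM /= bgd_src.
case: convS_bal => bl br bs; move: d y; apply: beta_gen.
- split=> [n m m'|m n n'|a m n].
  + by rewrite bl sw_argD.
  + by rewrite br sw_argD.
  + by rewrite bs.
- split=> [n m m'|m n n'|a m n].
  + by rewrite -swD; apply: eq_sw => u v; rewrite convSD mulrDl Fl.
  + by rewrite raddfD sw_argD.
  + rewrite rmorphM /= bgd_src sw_srcl //.
    by apply: eq_sw => u v; rewrite convS_tgt mulrA.
move=> x y.
transitivity (sw (sw x (fun u v => convS u * alpha (v * y))) Phi).
  by rewrite (sw_sw _ _ bPhi).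
rewrite convS_sw sw_mul // sw_hom; last first.
  split=> [n m m'|m n n'|a m n].
  + by rewrite -swD; apply: eq_sw => u v; rewrite mulrDl /Phi Fl.
  + by rewrite -swD; apply: eq_sw => u v; rewrite mulrDl /Phi raddfD Fr.
  + apply: eq_sw => u v.
    by case: (bPhi) => _ _ Ps; rewrite -mulrA Ps mulrA.
transitivity (sw x (fun x1 x2 => sw x2 (fun u1 u2 => sw (alpha y) (fun u' v' =>
    F (convS x1 * (alpha u1 * u')) (rho (alpha u2 * v')))))); last first.
  apply: eq_sw => x1 x2; rewrite rmorphM /= sw_mul //= sw_hom //.
  have [b1 b2 b3] := bF2 x1.
  split=> [n m m'|m n n'|a m n].
  + by rewrite -swD; apply: eq_sw => u v; rewrite mulrDl b1.
  + by rewrite -swD; apply: eq_sw => u v; rewrite mulrDl b2.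
  + by apply: eq_sw => u v; rewrite -mulrA b3 !mulrA.
rewrite -sw_coassoc; last first.
  split=> [n|m].
  - split=> [v m m'|m v v'|a m v].
    + by rewrite -swD; apply: eq_sw => u w; rewrite convSD mulrDl Fl.
    + by rewrite -swD; apply: eq_sw => u w; rewrite raddfD mulrDl mulrDr Fl.
    + by apply: eq_sw => u w; rewrite convS_tgt (rmorphM alpha (src D a)) /= bgd_src !mulrA.
  have [b1 b2 b3] := bF2 m.
  split=> [v n n'|n v v'|a n v].
  + by rewrite -swD; apply: eq_sw => u w; rewrite raddfD mulrDl b1.
  + by rewrite -swD; apply: eq_sw => u w; rewrite raddfD mulrDl b2.
  + apply: eq_sw => u w; rewrite (rmorphM alpha (tgt D a)) (rmorphM alpha (src D a)) /=.
    by rewrite bgd_tgt bgd_src -mulrA b3 !mulrA.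
apply: eq_sw => x1 x2; rewrite sw_exchange; apply: eq_sw => u v.
(* In the second leg [rho_eq] trades [gamma] for [alpha]; in the first, [gamma] is expanded as the
   convolution of [convS] with [alpha]. *)
rewrite /Phi !rmorphM /= -rho_eq -convS_sw1.
rewrite (@sw_morph _ _ _ _ _ (fun w => F (w * u) (rho (alpha x2) * rho v))); last first.
  by move=> w w'; rewrite mulrDl Fl.
by apply: eq_sw => w1 w2; rewrite mulrA.
Qed.

End ConvolutionQuotient.

(** * The projection onto the coinvariants *)

Section BialgebroidHoms.
Variables (K : fieldType) (A : algType K).
Implicit Types D E : bialgebroid A.

Lemma cop_sw D (d : D) : cop D d = sw d (fun x y => tpure x y).
Proof. exact: cop_repE. Qed.

Lemma balA_hom_pure D E (f : bgd_hom D E) :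
  balA (fun x y : D => tpure (f x) (f y) : dtens E).
Proof.
split=> [n m m'|m n n'|a m n].
- by rewrite raddfD tpureDl.
- by rewrite raddfD tpureDr.
- by rewrite !rmorphM /= bgd_tgt bgd_src dtens_bal.
Qed.

Lemma tmap_id D (x : dtens D) : tmap id id x = x :> dtens D.
Proof.
have b : balA (fun x y : D => tpure (id x) (id y) : dtens D) := balanced_tpure _ _.
by move: x; apply: tens_eq => [||m n] //; [exact: (tliftD b) | exact: (tliftE b)].
Qed.

Lemma id_cop D (d : D) : cop D (idfun d) = tmap idfun idfun (cop D d).
Proof. by rewrite tmap_id. Qed.

Definition bgd_id D : bgd_hom D D :=
  @BgdHom K A D D idfun (fun=> erefl) (fun=> erefl) (@id_cop D) (fun=> erefl).

Section Composition.
Variables (D E F : bialgebroid A) (g : bgd_hom E F) (f : bgd_hom D E).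

Lemma comp_src a : (g \o f) (src D a) = src F a.
Proof. by rewrite /= !bgd_src. Qed.

Lemma comp_tgt a : (g \o f) (tgt D a) = tgt F a.
Proof. by rewrite /= !bgd_tgt. Qed.

Lemma comp_eps d : eps F ((g \o f) d) = eps D d.
Proof. by rewrite /= !bgd_eps. Qed.

Lemma comp_cop d : cop F ((g \o f) d) = tmap (g \o f) (g \o f) (cop D d).
Proof.
have b : balA (fun x y : D => tpure ((g \o f) x) ((g \o f) y) : dtens F).
  have [b1 b2 b3] := balA_hom_pure g.
  split=> [n m m'|m n n'|a m n] /=.
  - by rewrite raddfD b1.
  - by rewrite raddfD b2.
  - by rewrite !rmorphM /= !bgd_tgt !bgd_src dtens_bal.
rewrite /= bgd_cop /tmap -(swE _ b) -(swE _ (balA_hom_pure g)).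
by rewrite (sw_hom _ _ (balA_hom_pure g)).
Qed.

Definition bgd_comp : bgd_hom D F :=
  @BgdHom K A D F (g \o f) comp_src comp_tgt comp_cop comp_eps.

End Composition.
End BialgebroidHoms.

Section Projection.
Variables (K : fieldType) (A : algType K) (H2 H1 : hopf_algebroid A).
Variables (pi : bgd_hom H2 H1) (iota : bgd_hom H1 H2).
Hypothesis pi_iota : forall y : H1, pi (iota y) = y.

Definition iotapi : bgd_hom H2 H2 := bgd_comp iota pi.

(* [prj d = d_+ * iota (pi d_-)], classically [d_(1) * iota (pi (S d_(2)))]. *)
Definition prj : H2 -> H2 := convS (bgd_id H2) iotapi.

Lemma prjD : {morph prj : x y / x + y}. Proof. exact: convSD. Qed.
Lemma prj_src a d : prj (src H2 a * d) = src H2 a * prj d. Proof. exact: convS_src. Qed.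
Lemma prj_tgt a d : prj (tgt H2 a * d) = prj d * src H2 a. Proof. exact: convS_tgt. Qed.
Lemma prj_tgtC a d : tgt H2 a * prj d = prj d * tgt H2 a. Proof. exact: convS_tgtC. Qed.

Lemma fixed_tgtC a b : prj b = b -> tgt H2 a * b = b * tgt H2 a.
Proof. by move=> <-; apply: prj_tgtC. Qed.

Lemma prj_sw d y : sw d (fun u v => prj u * iota (pi v * y)) = d * iota y.
Proof.
have := convS_sw (bgd_id H2) iotapi d (iota y); rewrite /= pi_iota => <-.
by apply: eq_sw => u v /=; rewrite (rmorphM pi v) /= pi_iota.
Qed.

Lemma prj_sw1 d : sw d (fun u v => prj u * iota (pi v)) = d.
Proof. exact: (convS_sw1 (bgd_id H2) iotapi). Qed.

Lemma prj_coinv (Z : zmodType) (F : H2 -> H1 -> Z) d : balA F ->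
  sw (prj d) (fun u v => F u (pi v)) = F (prj d) 1.
Proof. by apply: convS_coinv => x /=; rewrite pi_iota. Qed.

Lemma balA_prjiota (y : H2) (k : H1) : balA (fun u h => prj (u * y) * iota (h * k)).
Proof.
split=> [n m m'|m n n'|a m n].
- by rewrite mulrDl prjD mulrDl.
- by rewrite mulrDl raddfD mulrDr.
- by rewrite -mulrA prj_tgt !rmorphM /= bgd_src !mulrA.
Qed.

Lemma balA_prj : balA (fun u (h : H1) => prj u * iota h).
Proof.
by have := balA_prjiota 1 1; congr balA; do 2!(apply/funext => ?); rewrite !mulr1.
Qed.

Lemma balA_prjpi : balA (fun u v => prj u * iota (pi v)).
Proof. exact: (balA_hom_r pi balA_prj). Qed.

(** [prj_sw1] rebuilds prj d from its coproduct, and coinvariance reduces that sum to prj (prj d) *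
    1. *)
Lemma prj_idem d : prj (prj d) = prj d.
Proof.
rewrite -[RHS]prj_sw1.
by rewrite (prj_coinv _ balA_prj) rmorph1 mulr1.
Qed.

(** Classically b h_(1) S h_(2) = b eps(h). After multiplication by iota k, both sides equal b *
    iota x * iota y on the generators of H1 (x)_A H1: one by coinvariance of b and [prj_sw], the
    other by the counit law. *)
Lemma prj_iota_fixed b h : prj b = b -> prj (b * iota h) = b * src H2 (eps H1 h).
Proof.
move=> Pb.
suff S k : prj (b * iota h) * iota k = b * src H2 (eps H1 h) * iota k.
  by have := S 1; rewrite rmorph1 !mulr1.
move: h k; apply: beta_gen.
- split=> [n m m'|m n n'|a m n].
  + by rewrite raddfD mulrDr prjD mulrDl.
  + by rewrite raddfD mulrDr.
  + rewrite !rmorphM /= bgd_tgt bgd_src mulrA.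
    by rewrite -(fixed_tgtC _ Pb) -mulrA prj_tgt mulrA.
- split=> [n m m'|m n n'|a m n].
  + by rewrite !raddfD mulrDr mulrDl.
  + by rewrite raddfD mulrDr.
  + by rewrite eps_tgt !rmorphM /= bgd_src !mulrA.
move=> x y; transitivity (b * iota x * iota y).
  have bPhi : balA (fun u v => prj u * iota (pi v * y)).
    split=> [n m m'|m n n'|a m n].
    + by rewrite prjD mulrDl.
    + by rewrite raddfD mulrDl raddfD mulrDr.
    + by rewrite prj_tgt !rmorphM /= !bgd_src !mulrA.
  rewrite -(prj_sw (b * iota x)) sw_mulC // sw_hom; last exact: (balA_sw_mull b bPhi).
  apply: eq_sw => x1 x2; rewrite -{1}Pb -[x2 * y]mul1r.
  rewrite -(prj_coinv _ (balA_prjiota (iota x1) (x2 * y))) Pb.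
  by apply: eq_sw => u v; rewrite (rmorphM pi v) /= pi_iota mulrA.
transitivity (sw x (fun x1 x2 => b * iota (src H1 (eps H1 x1) * x2 * y))).
  rewrite (sw_epsl x (F := fun w => b * iota (w * y))) ?rmorphM ?mulrA // => w w'.
  by rewrite mulrDl raddfD mulrDr.
by apply: eq_sw => x1 x2; rewrite !rmorphM /= bgd_src !mulrA.
Qed.

Lemma eps_mul_src (D : bialgebroid A) (x y : D) :
  eps D (x * src D (eps D y)) = eps D (x * y).
Proof. by rewrite [RHS]epsM_src. Qed.

Lemma eps_srcE (D : bialgebroid A) a : eps D (src D a) = a.
Proof. by rewrite -[src D a]mulr1 eps_src eps1 mulr1. Qed.

Lemma eps_tgtE (D : bialgebroid A) a : eps D (tgt D a) = a.
Proof. by rewrite -[tgt D a]mulr1 eps_tgt eps1 mul1r. Qed.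

(** Writing x * iota h as the sum of prj x_(1) * iota (pi x_(2) * h) reduces to the coinvariant
    case; the counit of pi x_(2) * h depends on h only through eps h. *)
Lemma prj_iota x h : prj (x * iota h) = prj (x * src H2 (eps H1 h)).
Proof.
have E k : prj (x * iota k) = sw x (fun u v => prj u * src H2 (eps H1 (pi v * k))).
  rewrite -prj_sw (sw_morph _ _ prjD); apply: eq_sw => u v.
  by rewrite prj_iota_fixed ?prj_idem.
rewrite E -(bgd_src iota) E; apply: eq_sw => u v.
by rewrite eps_mul_src.
Qed.

Lemma prj_srcr_tgtr x a : prj (x * src H2 a) = prj (x * tgt H2 a).
Proof. by rewrite -(bgd_tgt iota) prj_iota eps_tgtE. Qed.

Lemma prj_sw_eps (Z : zmodType) (F : H2 -> Z) d : {morph F : x y / x + y} ->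
  sw d (fun u v => F (prj u * src H2 (eps H2 v))) = F (prj d).
Proof.
move=> FD; under eq_sw do rewrite -prj_tgt.
by rewrite (sw_epsr d (F := fun w => F (prj w))) // => x y; rewrite prjD FD.
Qed.

(** In the expansion of b * b' by [prj_sw1], coinvariance of b' and then of b removes the factors
    under [pi]. The inner sum over b is balanced by the Takeuchi condition. *)
Lemma prj_fixedM b b' : prj b = b -> prj b' = b' -> prj (b * b') = b * b'.
Proof.
move=> Pb Pb'.
pose F x h := sw b (fun u v => prj (u * x) * iota (pi v * h)).
have bF : balA F.
  split=> [n m m'|m n n'|a m n]; rewrite /F.
  - by rewrite -swD; apply: eq_sw => u v; rewrite mulrDr prjD mulrDl.
  - by rewrite -swD; apply: eq_sw => u v; rewrite mulrDr raddfD mulrDr.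
  transitivity (sw b (fun u v => prj (u * tgt H2 a * m) * iota (pi v * n))).
    by apply: eq_sw => u v; rewrite mulrA.
  rewrite (sw_takeuchi _ _ (balA_hom_r pi (balA_prjiota m n))).
  by apply: eq_sw => u v; rewrite (rmorphM pi v) /= bgd_src mulrA.
rewrite -[RHS]prj_sw1 (sw_mulC _ _ balA_prjpi) -[in RHS]Pb'.
transitivity (sw (prj b') (fun x y => F x (pi y))); last first.
  by apply: eq_sw => x y; apply: eq_sw => u v; rewrite (rmorphM pi v).
rewrite prj_coinv // Pb' /F -[in RHS]Pb (prj_coinv _ (balA_prjiota b' 1)) Pb.
by rewrite !mul1r rmorph1 mulr1.
Qed.

(** Allows inner projections to be dropped; associativity of the action h |> b = prj (iota h * b) is
    the first use. *)
Lemma prj_mulP x d : prj (x * prj d) = prj (x * d).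
Proof.
rewrite -(prj_sw_eps d (F := fun w => prj (x * w))); last first.
  by move=> u v; rewrite mulrDr prjD.
rewrite -[in RHS](prj_sw1 d) (sw_morph (f := fun w => prj (x * w))); last first.
  by move=> u v; rewrite mulrDr prjD.
by apply: eq_sw => u v; rewrite !mulrA prj_iota bgd_eps.
Qed.

Lemma prj1 : prj 1 = 1.
Proof. by have := prj_sw1 1; rewrite (sw1 balA_prjpi) !rmorph1 mulr1. Qed.

Lemma eps_prj d : eps H2 (prj d) = eps H2 d.
Proof.
rewrite -[in RHS](prj_sw1 d) (sw_morph (f := eps H2)); last exact: raddfD.
rewrite -(prj_sw_eps d (F := eps H2)); last exact: raddfD.
by apply: eq_sw => u v; rewrite -[RHS]eps_mul_src !bgd_eps.
Qed.

(** The counit applied to the first leg of the coinvariance relation of prj d. *)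
Lemma pi_prj d : pi (prj d) = src H1 (eps H2 d).
Proof.
rewrite -[LHS](sw_epsl (prj d) (F := pi)); last exact: raddfD.
have bF : balA (fun (u : H2) (h : H1) => src H1 (eps H2 u) * h).
  split=> [n m m'|m n n'|a m n].
  - by rewrite !raddfD mulrDl.
  - by rewrite mulrDr.
  - by rewrite eps_tgt rmorphM mulrA.
rewrite -(eps_prj d) -[RHS]mulr1 -(prj_coinv _ bF).
by apply: eq_sw => u v; rewrite rmorphM /= bgd_src.
Qed.

Lemma prj_srcE a : prj (src H2 a) = src H2 a.
Proof. by rewrite -[src H2 a]mulr1 prj_src prj1 mulr1. Qed.

Lemma eps_fixedM b b' : prj b = b -> eps H2 (b * b') = eps H2 b * eps H2 b'.
Proof.
by move=> Pb; rewrite epsM_tgt -(fixed_tgtC _ Pb) eps_tgt.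
Qed.

(** Expanding the second leg gives b_(1) (x) prj b_(2) * iota (pi b_(3)), and coinvariance of b
    replaces the last factor by 1. So the coproduct of H2, the half-braiding and the coproduct of B
    can be compared without projecting the second leg. *)
Lemma sw_fixed_prj (Z : zmodType) (F : H2 -> H2 -> Z) b : prj b = b -> balA F ->
  sw b (fun u v => F u (prj v)) = sw b F.
Proof.
move=> Pb bF; case: (bF) => Fl Fr Fs.
have bG : balA3 (fun x y z => F x (prj y * iota (pi z))).
  split=> [z|x]; split=> [n m m'|m n n'|a m n].
  - by rewrite Fl.
  - by rewrite prjD mulrDl Fr.
  - by rewrite Fs prj_src mulrA.
  - by rewrite prjD mulrDl Fr.
  - by rewrite !raddfD mulrDr Fr.
  - by rewrite prj_tgt !rmorphM /= !bgd_src mulrA.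
transitivity (sw b (fun x y => sw y (fun y1 y2 => F x (prj y1 * iota (pi y2))))); last first.
  by apply: eq_sw => x y; rewrite -[in RHS](prj_sw1 y) (sw_morph _ _ (Fr x)).
rewrite -(sw_coassoc _ bG).
pose G x h := sw x (fun x1 x2 => F x1 (prj x2 * iota h)).
have bx h : balA (fun x1 x2 => F x1 (prj x2 * iota h)).
  split=> [n m m'|m n n'|a m n].
  - by rewrite Fl.
  - by rewrite prjD mulrDl Fr.
  - by rewrite Fs prj_src mulrA.
have bGG : balA G.
  split=> [n m m'|m n n'|a m n].
  - exact: sw_argD.
  - by rewrite /G -swD; apply: eq_sw => u v; rewrite raddfD mulrDr Fr.
  - rewrite /G sw_tgtl //; apply: eq_sw => u v.
    by rewrite prj_tgt rmorphM /= bgd_src mulrA.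
rewrite -Pb -/(sw (prj b) (fun x y => G x (pi y))) (prj_coinv _ bGG).
by apply: eq_sw => u v; rewrite rmorph1 mulr1.
Qed.

End Projection.

(** * The antipode of the coinvariants *)

Section Antipode.
Variables (K : fieldType) (A : algType K) (H2 H1 : hopf_algebroid A).
Variables (pi : bgd_hom H2 H1) (iota : bgd_hom H1 H2).
Hypothesis pi_iota : forall y : H1, pi (iota y) = y.
Local Notation prj := (prj pi iota).
Local Notation iotapi := (iotapi pi iota).

(* [ant d = iota (pi d_+) * d_-], classically [iota (pi d_(1)) * S d_(2)]. *)
Definition ant : H2 -> H2 := convS iotapi (bgd_id H2).

Lemma antD : {morph ant : x y / x + y}. Proof. exact: convSD. Qed.
Lemma ant_src a d : ant (src H2 a * d) = src H2 a * ant d. Proof. exact: convS_src. Qed.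
Lemma ant_tgt a d : ant (tgt H2 a * d) = ant d * src H2 a. Proof. exact: convS_tgt. Qed.
Lemma ant_sw d y : sw d (fun u v => ant u * (v * y)) = iota (pi d) * y.
Proof. exact: (convS_sw iotapi (bgd_id H2)). Qed.
Lemma ant_sw1 d : sw d (fun u v => ant u * v) = iota (pi d).
Proof. exact: (convS_sw1 iotapi (bgd_id H2)). Qed.

Lemma ant_bal x y : balA (fun u v => ant (u * x) * (v * y)).
Proof.
have := convS_bal iotapi (bgd_id H2); exact: balA_mulrr.
Qed.

Lemma ant_bal1 : balA (fun u v => ant u * v).
Proof. exact: (convS_bal iotapi (bgd_id H2)). Qed.

(** [convS_coinv] with the two morphisms interchanged: [pi] still identifies them. *)
Lemma prj_ant d : prj (ant d) = ant d.
Proof.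
rewrite -[RHS](prj_sw1 pi iota).
have E : forall F : H2 -> H1 -> H2, balA F ->
    sw (ant d) (fun u v => F u (pi v)) = F (ant d) 1.
  by move=> F; apply: convS_coinv => x /=; rewrite pi_iota.
by rewrite (E _ (balA_prj pi iota)) rmorph1 mulr1.
Qed.

(** Classically iota (pi x_(1)) h_(1) S(h_(2)) S(x_(2)), in which the factors from h collapse to a
    counit. *)
Lemma ant_iota_tgt x h : ant (x * iota h) = ant (x * tgt H2 (eps H1 h)).
Proof.
(* Two rounds of generation: here (h, k) runs over generators of H1 (x)_A H1, where both sides
   become iota (pi (z * iota h)) * iota k; at the end (x, y) runs over those of H2 (x)_A H2. *)
have E z k : sw z (fun u v => ant (u * iota h) * (v * iota k))
         = sw z (fun u v => ant (u * tgt H2 (eps H1 h)) * (v * iota k)).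
  move: h k; apply: beta_gen.
  - split=> [n m m'|m n n'|a m n].
    + by rewrite -swD; apply: eq_sw => u v; rewrite raddfD mulrDr antD mulrDl.
    + by rewrite -swD; apply: eq_sw => u v; rewrite raddfD !mulrDr.
    + rewrite !rmorphM /= bgd_tgt bgd_src.
      apply: etrans (etrans _ (sw_takeuchi a z (ant_bal (iota m) (iota n)))) _.
        by apply: eq_sw => u v; rewrite !mulrA.
      by apply: eq_sw => u v; rewrite !mulrA.
  - split=> [n m m'|m n n'|a m n].
    + by rewrite -swD; apply: eq_sw => u v; rewrite !raddfD mulrDr antD mulrDl.
    + by rewrite -swD; apply: eq_sw => u v; rewrite raddfD !mulrDr.
    + rewrite eps_tgt (rmorphM (tgt H2) a (eps H1 m)) rmorphM /= bgd_src.
      apply: etrans (etrans _ (sw_takeuchi a z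
        (ant_bal (tgt H2 (eps H1 m)) (iota n)))) _.
        by apply: eq_sw => u v; rewrite !mulrA.
      by apply: eq_sw => u v; rewrite !mulrA.
  move=> {}h k; transitivity (iota (pi (z * iota h)) * iota k).
    have bPhi : balA (fun u v => ant u * (v * iota k)).
      by have := ant_bal 1 (iota k); congr balA; do 2!(apply/funext => ?); rewrite !mulr1.
    rewrite -ant_sw sw_mulC // sw_hom; last exact: (balA_sw_mull z bPhi).
    by apply: eq_sw => h1 h2; apply: eq_sw => u v; rewrite rmorphM !mulrA.
  transitivity (sw h (fun h1 h2 => sw z (fun u v =>
     ant u * (v * iota (src H1 (eps H1 h1) * h2 * k))))); last first.
    apply: eq_sw => h1 h2; rewrite -[LHS]addr0.
    have := sw_takeuchi (eps H1 h1) z (ant_bal 1 (iota (h2 * k))).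
    rewrite addr0; under eq_sw do rewrite mulr1; move=> ->.
    by apply: eq_sw => u v; rewrite mulr1 !rmorphM /= bgd_src !mulrA.
  rewrite (sw_epsl h (F := fun w => sw z (fun u v => ant u * (v * iota (w * k))))).
    by rewrite ant_sw !rmorphM /= pi_iota !mulrA.
  by move=> w w'; rewrite -swD; apply: eq_sw => u v; rewrite mulrDl raddfD !mulrDr.
suff AE y : ant (x * iota h) * y = ant (x * tgt H2 (eps H1 h)) * y.
  by have := AE 1; rewrite !mulr1.
have bal w : balA (fun u y => ant (u * w) * y).
  by have := ant_bal w 1; congr balA; do 2!(apply/funext => ?); rewrite mulr1.
move: x y; apply: beta_gen; [exact: bal | exact: bal |].
move=> x y; have := congr1 (fun w => w * y) (E x 1); rewrite rmorph1.
rewrite !(sw_morph (f := fun w => w * y)); try by move=> ? ?; rewrite mulrDl.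
move=> {}E; apply: etrans (etrans E _); apply: eq_sw => u v; by rewrite mulr1 !mulrA.
Qed.

Lemma ant_srcr_tgtr x a : ant (x * src H2 a) = ant (x * tgt H2 a).
Proof. by rewrite -(bgd_src iota) ant_iota_tgt eps_srcE. Qed.

(** Both maps see a right factor from H1 only through its counit, so [ant] factors through [prj] and
    descends to B. *)
Lemma ant_prj d : ant (prj d) = ant d.
Proof.
rewrite -[in RHS](prj_sw1 pi iota d) (sw_morph _ _ antD).
rewrite -(prj_sw_eps pi iota d antD); apply: eq_sw => u v.
by rewrite ant_iota_tgt bgd_eps ant_srcr_tgtr.
Qed.

(** Multiplying by iota h_(2) cancels the antipode of iota h_(1) * d; applying [prj] to this gives
    the H1-linearity of the antipode in [ant_iotal]. *)
Lemma ant_iotal_sw h d :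
  sw h (fun h1 h2 => ant (iota h1 * d) * iota h2) = iota h * ant d.
Proof.
suff AE y : sw h (fun h1 h2 => ant (iota h1 * d) * (iota h2 * y)) = iota h * ant d * y.
  by have := AE 1; rewrite mulr1 => <-; apply: eq_sw => u v; rewrite mulr1.
have [b1 b2 b3] := ant_bal1.
move: d y; apply: beta_gen.
- split=> [n m m'|m n n'|a m n].
  + by rewrite -swD; apply: eq_sw => u v; rewrite mulrDr antD mulrDl.
  + by rewrite -swD; apply: eq_sw => u v; rewrite !mulrDr.
  + have b : balA (fun h1 h2 => ant (iota h1 * m) * (iota h2 * n)).
      split=> [z w w'|w z z'|c w z].
      * by rewrite raddfD mulrDl b1.
      * by rewrite raddfD mulrDl b2.
      * by rewrite !rmorphM /= bgd_tgt bgd_src -!mulrA b3.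
    apply: etrans (etrans _ (sw_takeuchi a h b)) _; apply: eq_sw => u v.
      by rewrite rmorphM /= bgd_tgt !mulrA.
    by rewrite rmorphM /= bgd_src !mulrA.
- split=> [n m m'|m n n'|a m n]; rewrite -!mulrA.
  + by rewrite b1 mulrDr.
  + by rewrite b2 mulrDr.
  + by rewrite b3.
move=> x y; transitivity (iota (pi (iota h * x)) * y).
  have bPhi : balA (fun u v => ant u * (v * y)).
    by have := ant_bal 1 y; congr balA; do 2!(apply/funext => ?); rewrite !mulr1.
  rewrite -ant_sw sw_mulC //; apply: eq_sw => u v; rewrite sw_hom.
    by apply: eq_sw => h1 h2; rewrite !mulrA.
  exact: balA_mulrr bPhi.
rewrite rmorphM /= pi_iota rmorphM -mulrA -ant_sw.
rewrite (sw_morph (f := fun w => iota h * w)); last by move=> ? ?; rewrite mulrDr.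
by apply: eq_sw => u v; rewrite !mulrA.
Qed.

Lemma ant_iotal h d : ant (iota h * d) = prj (iota h * ant d).
Proof.
rewrite -ant_iotal_sw (sw_morph _ _ (prjD pi iota)).
rewrite -(sw_epsr h (F := fun w => ant (iota w * d))); last first.
  by move=> u v; rewrite raddfD mulrDl antD.
apply: eq_sw => u v; rewrite (prj_iota_fixed pi_iota _ (prj_ant _)).
by rewrite rmorphM /= bgd_tgt -mulrA ant_tgt.
Qed.

(** On generators, ant x_(2) * x_(3) becomes iota (pi x_(2)), and prj x_(1) * iota (pi x_(2))
    rebuilds x. *)
Lemma prj_ant_sw d : sw d (fun u v => prj u * ant v) = src H2 (eps H2 d).
Proof.
suff AE y : sw d (fun u v => prj u * (ant v * y)) = src H2 (eps H2 d) * y.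
  by have := AE 1; rewrite mulr1 => <-; apply: eq_sw => u v; rewrite mulr1.
have b z : balA (fun u v => prj u * (ant v * z)).
  split=> [n m m'|m n n'|a m n].
  - by rewrite prjD mulrDl.
  - by rewrite antD mulrDl mulrDr.
  - by rewrite prj_tgt ant_src !mulrA.
move: d y; apply: beta_gen.
- split=> [n m m'|m n n'|a m n].
  + by rewrite sw_argD.
  + by rewrite -swD; apply: eq_sw => u v; rewrite !mulrDr.
  + rewrite sw_tgtl //; apply: eq_sw => u v.
    by rewrite ant_tgt !mulrA.
- split=> [n m m'|m n n'|a m n].
  + by rewrite !raddfD mulrDl.
  + by rewrite mulrDr.
  + by rewrite eps_tgt rmorphM /= mulrA.
move=> x y; rewrite (sw_coassoc x (F := fun x1 x2 x3 => prj x1 * (ant x2 * (x3 * y)))).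
  transitivity (x * y).
    rewrite -[in RHS](prj_sw1 pi iota x).
    rewrite (sw_morph (f := fun w => w * y)); last by move=> ? ?; rewrite mulrDl.
    apply: eq_sw => u v; rewrite -mulrA -ant_sw.
    by rewrite (sw_morph (f := fun w => prj u * w)) // => ? ?; rewrite mulrDr.
  rewrite -(sw_epsl x (F := fun w => w * y)); last by move=> ? ?; rewrite mulrDl.
  by apply: eq_sw => u v; rewrite mulrA.
split=> [z|x0]; first exact: b.
split=> [n m m'|m n n'|a m n].
- by rewrite antD mulrDl mulrDr.
- by rewrite mulrDl !mulrDr.
- by rewrite ant_tgt !mulrA.
Qed.

(** Write e for the composite of [iota] after [pi]. Classically the coproduct of ant d is e(d_(1))
    S(d_(4)) (x) e(d_(2)) S(d_(3)); a factor d_(5) on the first leg cancels S(d_(4)) and leaves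
    e(d_(1)) (x) ant d_(2). On generators w_(1) (x) w_(2) z both sides become F (e w_(1)) (e w_(2) *
    z). *)
Lemma ant_cop_sw (Z : zmodType) (F : H2 -> H2 -> Z) d : balA F ->
  sw d (fun x y => sw (ant x) (fun u v => F (u * y) v))
    = sw d (fun x y => F (iota (pi x)) (ant y)).
Proof.
move=> bF; have [Fl Fr Fs] := bF.
suff AE z : sw d (fun x y => sw (ant x) (fun u v => F (u * y) (v * z)))
          = sw d (fun x y => F (iota (pi x)) (ant y * z)).
  have := AE 1; under [in LHS]eq_sw do under eq_sw do rewrite mulr1.
  by under [in RHS]eq_sw do rewrite mulr1.
have bz c : balA (fun u v => F u (v * c)).
  by have := balA_mulrr 1 c bF; congr balA; do 2!(apply/funext => ?); rewrite !mulr1.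
have bL c : balA (fun x y => sw (ant x) (fun u v => F (u * y) (v * c))).
  split=> [n m m'|m n n'|a m n].
  - by rewrite antD sw_argD //; apply: balA_mulrr.
  - by rewrite -swD; apply: eq_sw => u v; rewrite mulrDr Fl.
  - rewrite ant_tgt sw_srcr; last exact: balA_mulrr.
    by apply: eq_sw => u v; rewrite mulrA.
have bR c : balA (fun x y => F (iota (pi x)) (ant y * c)).
  split=> [n m m'|m n n'|a m n].
  - by rewrite !raddfD Fl.
  - by rewrite antD mulrDl Fr.
  - by rewrite !rmorphM /= !bgd_tgt Fs ant_src mulrA.
move: d z; apply: beta_gen.
- split=> [n m m'|m n n'|a m n].
  + by rewrite sw_argD.
  + rewrite -swD; apply: eq_sw => x y; rewrite -swD; apply: eq_sw => u v.
    by rewrite mulrDr Fr.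
  + rewrite sw_tgtl //; apply: eq_sw => x y.
    apply: etrans (etrans _ (sw_takeuchi a (ant x) (balA_mulrr y n bF))) _;
      by apply: eq_sw => u v; rewrite !mulrA.
- split=> [n m m'|m n n'|a m n].
  + by rewrite sw_argD.
  + by rewrite -swD; apply: eq_sw => x y; rewrite mulrDr Fr.
  + by rewrite sw_tgtl //; apply: eq_sw => x y; rewrite ant_tgt mulrA.
move=> w z.
transitivity (sw w (fun x y => F (iota (pi x)) (iota (pi y) * z))).
  rewrite (sw_coassoc w (F := fun x y w2 =>
    sw (ant x) (fun u v => F (u * y) (v * (w2 * z))))); last first.
    split=> [x3|x1]; first exact: bL.
    split=> [n m m'|m n n'|a m n].
    + by rewrite -swD; apply: eq_sw => u v; rewrite mulrDr Fl.
    + by rewrite -swD; apply: eq_sw => u v; rewrite mulrDl mulrDr Fr.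
    + apply: etrans (etrans _ (sw_takeuchi a (ant x1) (balA_mulrr m (n * z) bF))) _;
        by apply: eq_sw => u v; rewrite !mulrA.
  transitivity (sw (sw w (fun x y => ant x * y)) (fun u v => F u (v * z))).
    rewrite (sw_sw _ _ (bz z)); apply: eq_sw => x y; rewrite (sw_mulC _ _ (bz z)).
    by apply: eq_sw => u v; apply: eq_sw => u' v'; rewrite mulrA.
  by rewrite ant_sw1 (sw_hom iotapi w (bz z)).
rewrite (sw_coassoc w (F := fun x y w2 => F (iota (pi x)) (ant y * (w2 * z)))).
  apply: eq_sw => x y; rewrite -ant_sw.
  by rewrite (sw_morph (f := F (iota (pi x)))) // => u v; rewrite Fr.
split=> [x3|x1]; first exact: bR.
split=> [n m m'|m n n'|a m n].
- by rewrite antD mulrDl Fr.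
- by rewrite mulrDl mulrDr Fr.
- by rewrite ant_tgt !mulrA.
Qed.

(** For a coinvariant b the extra factor of [ant_cop_sw] is 1 under [pi]. This is the compatibility
    of the antipode with the coaction, needed in [antB_br]. *)
Lemma ant_cop (Z : zmodType) (F : H1 -> H2 -> Z) b : prj b = b -> balA F ->
  sw (ant b) (fun u v => F (pi u) v) = sw b (fun u v => F (pi u) (ant v)).
Proof.
move=> Pb bF; have [Fl Fr Fs] := bF.
have bF' : balA (fun (u v : H2) => F (pi u) v).
  split=> [n m m'|m n n'|a m n].
  - by rewrite raddfD Fl.
  - by rewrite Fr.
  - by rewrite rmorphM /= bgd_tgt Fs.
have bh h : balA (fun (u v : H2) => F (pi u * h) v).
  split=> [n m m'|m n n'|a m n].
  - by rewrite raddfD mulrDl Fl.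
  - by rewrite Fr.
  - by rewrite rmorphM /= bgd_tgt -mulrA Fs.
pose G x h := sw (ant x) (fun u v => F (pi u * h) v).
have bG : balA G.
  split=> [n m m'|m n n'|a m n]; rewrite /G.
  - by rewrite antD sw_argD.
  - by rewrite -swD; apply: eq_sw => u v; rewrite mulrDr Fl.
  - rewrite ant_tgt sw_srcr //; apply: eq_sw => u v.
    by rewrite rmorphM /= bgd_src mulrA.
transitivity (sw b (fun x y => sw (ant x) (fun u v => F (pi (u * y)) v))).
  transitivity (sw b (fun x y => G x (pi y))).
    rewrite -Pb (prj_coinv pi_iota _ bG) /G; apply: eq_sw => u v.
    by rewrite mulr1.
  by apply: eq_sw => x y; apply: eq_sw => u v; rewrite rmorphM.
by rewrite (ant_cop_sw b bF'); apply: eq_sw => x y; rewrite pi_iota.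
Qed.

End Antipode.

(** * Tensor products of modules *)

Section ModuleTensor.
Variables (K : fieldType) (A : algType K) (H : bialgebroid A).
Implicit Types M N : lmodType H.

Definition balM M N (Z : zmodType) (F : M -> N -> Z) : Prop :=
  balanced (fun (a : A) (m : M) => tgt H a *: m) (fun (a : A) (n : N) => src H a *: n) F.

Definition mlift M N (Z : zmodType) (F : M -> N -> Z) (x : mtens M N) : Z := tlift F x.

Lemma mpureDl M N (m m' : M) (n : N) : mpure (m + m') n = mpure m n + mpure m' n.
Proof. exact: tpureDl. Qed.

Lemma mpureDr M N (m : M) (n n' : N) : mpure m (n + n') = mpure m n + mpure m n'.
Proof. exact: tpureDr. Qed.

Lemma mpure_bal M N a (m : M) (n : N) : mpure (tgt H a *: m) n = mpure m (src H a *: n).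
Proof.
exact: (@tpure_bal _ _ _ (fun (a : A) (m : M) => tgt H a *: m)
  (fun (a : A) (n : N) => src H a *: n)).
Qed.

Lemma mtens_eq M N (Z : zmodType) (F G : mtens M N -> Z) :
  {morph F : x y / x + y} -> {morph G : x y / x + y} ->
  (forall m n, F (mpure m n) = G (mpure m n)) -> F =1 G.
Proof. exact: tens_eq. Qed.

Lemma mliftE M N (Z : zmodType) (F : M -> N -> Z) : balM F ->
  forall m n, mlift F (mpure m n) = F m n.
Proof. exact: tliftE. Qed.

Lemma mliftD M N (Z : zmodType) (F : M -> N -> Z) : balM F ->
  {morph mlift F : x y / x + y}.
Proof. exact: tliftD. Qed.

Lemma mpure_act M N h (m : M) (n : N) :
  h *: mpure m n = sw h (fun h1 h2 => mpure (h1 *: m) (h2 *: n)).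
Proof. exact: (mtens_act_sum m n (cop_repE h)). Qed.

Lemma balA_mpure M N (m : M) (n : N) :
  balA (fun h1 h2 : H => mpure (h1 *: m) (h2 *: n)).
Proof.
split=> [z x y|z x y|a x y].
- by rewrite scalerDl mpureDl.
- by rewrite scalerDl mpureDr.
- by rewrite -!scalerA mpure_bal.
Qed.

Lemma mpure_src M N a (m : M) (n : N) : src H a *: mpure m n = mpure (src H a *: m) n.
Proof.
by rewrite mpure_act (sw_src _ (balA_mpure m n)) scale1r.
Qed.

Lemma mpure_tgt M N a (m : M) (n : N) : tgt H a *: mpure m n = mpure m (tgt H a *: n).
Proof. by rewrite mpure_act (sw_tgt _ (balA_mpure m n)) scale1r. Qed.

(** Maps of A-bimodules: enough for [mmap] to be well defined and stable under composition, so
    associators and composite braidings can be used inside [mmap] without proving them H-linear. *)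
Definition Abilin M N (u : M -> N) : Prop :=
  [/\ {morph u : x y / x + y},
      forall a m, u (src H a *: m) = src H a *: u m
    & forall a m, u (tgt H a *: m) = tgt H a *: u m].

Lemma Abilin_id M : Abilin (@id M).
Proof. by []. Qed.

Lemma Abilin_linear M N (u : {linear M -> N}) : Abilin u.
Proof. by split=> [x y|a m|a m]; rewrite ?raddfD ?linearZ. Qed.

Lemma Abilin_comp M N N' (v : N -> N') (u : M -> N) :
  Abilin v -> Abilin u -> Abilin (fun x => v (u x)).
Proof.
move=> [vD vs vt] [uD us ut]; split=> [x y|a m|a m].
- by rewrite uD vD.
- by rewrite us vs.
- by rewrite ut vt.
Qed.

Section Mmap.
Variables (M N M' N' : lmodType H) (u : M -> M') (v : N -> N').
Hypotheses (bu : Abilin u) (bv : Abilin v).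

Lemma mmap_bal : balM (fun m n => mpure (u m) (v n)).
Proof.
move: bu bv => [uD us ut] [vD vs vt]; split=> [n m m'|m n n'|a m n].
- by rewrite uD mpureDl.
- by rewrite vD mpureDr.
- by rewrite ut vs mpure_bal.
Qed.

Lemma mmapE m n : mmap u v (mpure m n) = mpure (u m) (v n).
Proof. exact: (mliftE mmap_bal). Qed.

Lemma mmapD : {morph mmap u v : x y / x + y}.
Proof. exact: (mliftD mmap_bal). Qed.

Lemma Abilin_mmap : Abilin (mmap u v).
Proof.
split=> [|a|a]; first exact: mmapD.
- apply: mtens_eq => [x y|x y|m n]; rewrite ?scalerDr ?mmapD ?scalerDr //.
  by case: bu => _ us _; rewrite mpure_src !mmapE us mpure_src.
- apply: mtens_eq => [x y|x y|m n]; rewrite ?scalerDr ?mmapD ?scalerDr //.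
  by case: bv => _ _ vt; rewrite mpure_tgt !mmapE vt mpure_tgt.
Qed.

End Mmap.

Section Massoc.
Variables M N P : lmodType H.
Let f2D (a : A) : {morph (fun x : mtens M N => tgt H a *: x) : x y / x + y}.
Proof. exact: scalerDr. Qed.
Let g4D (a : A) : {morph (fun x : mtens N P => src H a *: x) : x y / x + y}.
Proof. exact: scalerDr. Qed.
Let f2E a (m : M) (n : N) : tgt H a *: mpure m n = mpure m (tgt H a *: n).
Proof. exact: mpure_tgt. Qed.
Let g4E a (n : N) (p : P) : src H a *: mpure n p = mpure (src H a *: n) p.
Proof. exact: mpure_src. Qed.

Lemma massocD : {morph @massoc K A H M N P : x y / x + y}.
Proof. exact: (tassocD f2D f2E g4E). Qed.

Lemma massocE m n p : @massoc K A H M N P (mpure (mpure m n) p) = mpure m (mpure n p).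
Proof. exact: (tassocE f2D f2E g4E). Qed.

Lemma massocVD : {morph @massocV K A H M N P : x y / x + y}.
Proof. exact: (tassocVD g4D f2E g4E). Qed.

Lemma massocVE m n p : @massocV K A H M N P (mpure m (mpure n p)) = mpure (mpure m n) p.
Proof. exact: (tassocVE g4D f2E g4E). Qed.

Lemma mtens_eq3l (Z : zmodType) (F G : mtens (mtens M N) P -> Z) :
  {morph F : x y / x + y} -> {morph G : x y / x + y} ->
  (forall m n p, F (mpure (mpure m n) p) = G (mpure (mpure m n) p)) -> F =1 G.
Proof.
move=> FD GD FG; apply: mtens_eq => // x p; move: x.
apply: (mtens_eq (F := fun x => F (mpure x p)) (G := fun x => G (mpure x p))) => // x y.
- by rewrite mpureDl FD.
- by rewrite mpureDl GD.
Qed.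

Lemma mtens_eq3r (Z : zmodType) (F G : mtens M (mtens N P) -> Z) :
  {morph F : x y / x + y} -> {morph G : x y / x + y} ->
  (forall m n p, F (mpure m (mpure n p)) = G (mpure m (mpure n p))) -> F =1 G.
Proof.
move=> FD GD FG; apply: mtens_eq => // m.
apply: (mtens_eq (F := fun x => F (mpure m x)) (G := fun x => G (mpure m x))) => // x y.
- by rewrite mpureDr FD.
- by rewrite mpureDr GD.
Qed.

Lemma Abilin_massoc : Abilin (@massoc K A H M N P).
Proof.
split=> [|a|a]; first exact: massocD.
- apply: mtens_eq3l => [x y|x y|m n p]; rewrite ?scalerDr ?massocD ?scalerDr //.
  by rewrite !mpure_src !massocE mpure_src.
- apply: mtens_eq3l => [x y|x y|m n p]; rewrite ?scalerDr ?massocD ?scalerDr //.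
  by rewrite !mpure_tgt !massocE !mpure_tgt.
Qed.

Lemma Abilin_massocV : Abilin (@massocV K A H M N P).
Proof.
split=> [|a|a]; first exact: massocVD.
- apply: mtens_eq3r => [x y|x y|m n p]; rewrite ?scalerDr ?massocVD ?scalerDr //.
  by rewrite !mpure_src !massocVE !mpure_src.
- apply: mtens_eq3r => [x y|x y|m n p]; rewrite ?scalerDr ?massocVD ?scalerDr //.
  by rewrite !mpure_tgt !massocVE !mpure_tgt.
Qed.

End Massoc.

Section Units.
Variable M : lmodType H.

Lemma munit_srcE a (b : munit H) : src H a *: b = (a * (b : A) : munit H).
Proof. by rewrite -[RHS](@eps_srcE K A H) rmorphM. Qed.

Lemma munit_tgtE a (b : munit H) : tgt H a *: b = ((b : A) * a : munit H).
Proof. by rewrite /GRing.scale /= /munit_act eps_tgt eps_srcE. Qed.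

Lemma mlunit_bal : balM (fun (a : munit H) (m : M) => src H (a : A) *: m).
Proof.
split=> [n m m'|m n n'|a m n].
- by rewrite rmorphD scalerDl.
- by rewrite scalerDr.
- by rewrite munit_tgtE rmorphM scalerA.
Qed.

Lemma mrunit_bal : balM (fun (m : M) (a : munit H) => tgt H (a : A) *: m).
Proof.
split=> [n m m'|m n n'|a m n].
- by rewrite scalerDr.
- by rewrite rmorphD scalerDl.
- by rewrite munit_srcE (rmorphM (tgt H) (n : A) a) scalerA.
Qed.

Lemma mlunitD : {morph @mlunit K A H M : x y / x + y}.
Proof. exact: (mliftD mlunit_bal). Qed.
Lemma mrunitD : {morph @mrunit K A H M : x y / x + y}.
Proof. exact: (mliftD mrunit_bal). Qed.
Lemma mlunitE a m : @mlunit K A H M (mpure a m) = src H (a : A) *: m.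
Proof. exact: (mliftE mlunit_bal). Qed.
Lemma mrunitE m a : @mrunit K A H M (mpure m a) = tgt H (a : A) *: m.
Proof. exact: (mliftE mrunit_bal). Qed.

End Units.
End ModuleTensor.

(** * Coinvariants as an object of the center *)

Section CoinvariantType.
Variables (K : fieldType) (A : algType K) (H2 H1 : hopf_algebroid A).
Variables (pi : bgd_hom H2 H1) (iota : bgd_hom H1 H2).

(** By [prj_coinv] and [prj_sw1] the fixed points of [prj] are the solutions of b_(1) (x) pi b_(2) =
    b (x) 1; the fixed-point form is an equation in H2 rather than in a tensor product. *)
Definition fixed_pred : {pred H2} := fun b => prj pi iota b == b.

Lemma fixed_zmod_closed : zmod_closed fixed_pred.
Proof.
have prj0 : prj pi iota 0 = 0.
  by apply: (addIr (prj pi iota 0)); rewrite -prjD !add0r.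
split=> [|x y]; rewrite !unfold_in ?prj0 ?eqxx // => /eqP xP /eqP yP.
rewrite -[y in X in _ == X]yP -{2}xP; apply/eqP.
by apply: (addIr (prj pi iota y)); rewrite -prjD !subrK.
Qed.
HB.instance Definition _ := GRing.isZmodClosed.Build H2 fixed_pred fixed_zmod_closed.

Record coinv : Type := Coinv { coinv_val : H2; _ : coinv_val \in fixed_pred }.
HB.instance Definition _ := [isSub for coinv_val].
HB.instance Definition _ := [Choice of coinv by <:].
HB.instance Definition _ := [SubChoice_isSubZmodule of coinv by <:].

Hypothesis pi_iota : forall y : H1, pi (iota y) = y.

Lemma prj_in d : prj pi iota d \in fixed_pred.
Proof. by apply/eqP; apply: prj_idem. Qed.

Definition coinv_of (d : H2) : coinv := Coinv (prj_in d).

Definition coinv_act (h : H1) (b : coinv) : coinv := coinv_of (iota h * coinv_val b).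

Lemma coinv_actA h h' b : coinv_act h (coinv_act h' b) = coinv_act (h * h') b.
Proof. by apply: val_inj; rewrite /= prj_mulP // rmorphM mulrA. Qed.

Lemma coinv_act1 b : coinv_act 1 b = b.
Proof. by apply: val_inj; rewrite /= rmorph1 mul1r; apply/eqP; case: b. Qed.

Lemma coinv_actDr h : {morph coinv_act h : b b' / b + b'}.
Proof. by move=> b b'; apply: val_inj; rewrite /= mulrDr prjD. Qed.

Lemma coinv_actDl b : {morph coinv_act^~ b : h h' / h + h'}.
Proof. by move=> h h'; apply: val_inj; rewrite /= raddfD mulrDl prjD. Qed.

(** Packed explicitly: the action depends on [pi_iota], which cannot be inferred from the type
    [coinv]. *)
Definition coinv_mod : lmodType H1 := HB.pack coinv
  (GRing.Zmodule_isLmodule.Build H1 coinv coinv_actA coinv_act1 coinv_actDr coinv_actDl).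

End CoinvariantType.

(** * The tensor product of B with a module, and the half-braiding *)

Section Coinvariants.
Variables (K : fieldType) (A : algType K) (H2 H1 : hopf_algebroid A).
Variables (pi : bgd_hom H2 H1) (iota : bgd_hom H1 H2).
Hypothesis pi_iota : forall y : H1, pi (iota y) = y.

Local Notation prj := (prj pi iota).
Local Notation B := (coinv_mod pi_iota).

Definition cval (b : B) : H2 := coinv_val b.
Definition coB (d : H2) : B := coinv_of pi_iota d.

Lemma cval_inj : injective cval. Proof. exact: val_inj. Qed.
Lemma cvalD : {morph cval : b b' / b + b'}. Proof. by []. Qed.
Lemma cval_coB d : cval (coB d) = prj d. Proof. by []. Qed.
Lemma cval_fixed b : prj (cval b) = cval b. Proof. by case: b => b bP; apply/eqP. Qed.
Lemma coB_cval b : coB (cval b) = b.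
Proof. by apply: cval_inj; rewrite cval_coB cval_fixed. Qed.
Lemma coBD : {morph coB : x y / x + y}.
Proof. by move=> x y; apply: cval_inj; rewrite cvalD !cval_coB prjD. Qed.
Lemma coB_prj d : coB (prj d) = coB d.
Proof. by apply: cval_inj; rewrite !cval_coB prj_idem. Qed.
Lemma coB_mul_prj x d : coB (x * prj d) = coB (x * d).
Proof. by apply: cval_inj; rewrite !cval_coB prj_mulP. Qed.
Lemma scale_coB h d : h *: coB d = coB (iota h * d).
Proof. exact: coB_mul_prj. Qed.
Lemma scale_cval h b : h *: b = coB (iota h * cval b).
Proof. by []. Qed.
Lemma src_coB a d : src H1 a *: coB d = coB (src H2 a * d).
Proof. by rewrite scale_coB bgd_src. Qed.
Lemma tgt_coB a d : tgt H1 a *: coB d = coB (tgt H2 a * d).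
Proof. by rewrite scale_coB bgd_tgt. Qed.
Lemma cval_src a b : cval (src H1 a *: b) = src H2 a * cval b.
Proof. by rewrite -{1}(coB_cval b) src_coB cval_coB prj_src cval_fixed. Qed.
Lemma cval_tgt a b : cval (tgt H1 a *: b) = cval b * src H2 a.
Proof. by rewrite -{1}(coB_cval b) tgt_coB cval_coB prj_tgt cval_fixed. Qed.
Lemma coB_iota x h : coB (x * iota h) = coB (x * tgt H2 (eps H1 h)).
Proof. by apply: cval_inj; rewrite !cval_coB prj_iota // prj_srcr_tgtr. Qed.

Section Braiding.
Variable M : lmodType H1.

(* Under the isomorphism of [B (x)_A M] with [H2 (x)_{H1} M], [brk d m] is [d (x) m]. *)
Definition brk (d : H2) (m : M) : mtens B M :=
  sw d (fun x y => mpure (coB x) (pi y *: m)).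

Lemma brk_bal (m : M) : balA (fun x (h : H1) => mpure (coB x) (h *: m)).
Proof.
split=> [h x y|x h k|a x h].
- by rewrite coBD mpureDl.
- by rewrite scalerDl mpureDr.
- by rewrite -tgt_coB mpure_bal scalerA.
Qed.

Lemma brk_bal2 (m : M) : balA (fun x y => mpure (coB x) (pi y *: m)).
Proof. exact: (balA_hom_r pi (brk_bal m)). Qed.

Lemma brkDl m : {morph brk^~ m : d d' / d + d'}.
Proof. by move=> d d'; apply: sw_argD (brk_bal2 m). Qed.

Lemma brkDr d : {morph brk d : m m' / m + m'}.
Proof.
by move=> m m'; rewrite /brk -swD; apply: eq_sw => x y; rewrite scalerDr mpureDr.
Qed.

Lemma brk_cval b m : brk (cval b) m = mpure b m.
Proof.
rewrite /brk -cval_fixed (prj_coinv pi_iota _ (brk_bal m)) scale1r.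
by rewrite coB_prj coB_cval.
Qed.

(** The relation of H2 (x)_{H1} M: [coB] sees h_(1) only through its counit, Takeuchi moves that
    scalar to the second leg, and the counit law rebuilds h there. *)
Lemma brk_iota d h m : brk (d * iota h) m = brk d (h *: m).
Proof.
rewrite /brk (sw_mulC _ _ (brk_bal2 m)) sw_hom; last exact: (balA_sw_mull d (brk_bal2 m)).
transitivity (sw h (fun h1 h2 => sw d (fun x y =>
    mpure (coB x) (pi y *: ((src H1 (eps H1 h1) * h2) *: m))))).
  apply: eq_sw => h1 h2.
  transitivity (sw d (fun x y =>
      mpure (coB (x * tgt H2 (eps H1 h1))) (pi y *: (h2 *: m)))).
    by apply: eq_sw => x y; rewrite coB_iota (rmorphM pi) /= pi_iota scalerA.
  rewrite (sw_takeuchi _ _ (brk_bal2 (h2 *: m))).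
  by apply: eq_sw => x y; rewrite rmorphM /= bgd_src -!scalerA.
rewrite (sw_epsl h (F := fun w => sw d (fun x y => mpure (coB x) (pi y *: (w *: m))))) //.
move=> w w'; rewrite -swD; apply: eq_sw => x y.
by rewrite scalerDl scalerDr mpureDr.
Qed.

Lemma brk_act h d m : h *: brk d m = brk (iota h * d) m.
Proof.
rewrite /brk (sw_mul _ _ (brk_bal2 m)) sw_hom.
  rewrite (sw_morph (f := fun w => h *: w)); last exact: scalerDr.
  rewrite sw_exchange; apply: eq_sw => x y; rewrite mpure_act.
  by apply: eq_sw => h1 h2; rewrite scale_coB scalerA (rmorphM pi) /= pi_iota.
split=> [z u v|z u v|a u v].
- by rewrite -swD; apply: eq_sw => x y; rewrite mulrDl coBD mpureDl.
- by rewrite -swD; apply: eq_sw => x y; rewrite mulrDl raddfD scalerDl mpureDr.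
- by apply: eq_sw => x y; rewrite -!mulrA; case: (brk_bal2 m) => _ _ ->.
Qed.

Lemma tau_bal_pure (m : M) : balA (fun x y : H2 => mpure (pi x *: m) (coB y)).
Proof.
split=> [z u v|z u v|a u v].
- by rewrite raddfD scalerDl mpureDl.
- by rewrite coBD mpureDr.
- by rewrite rmorphM /= bgd_tgt -scalerA mpure_bal src_coB.
Qed.

(** The half-braiding on H2 (x)_{H1} M, for arbitrary d, so that H-linearity of [tau] is read off
    from the product iota h * d. *)
Definition tau_brk (d : H2) (m : M) : mtens M B :=
  sw d (fun x y => mpure (pi x *: m) (coB y)).

Lemma tau_brk_iota d h m : tau_brk (d * iota h) m = tau_brk d (h *: m).
Proof.
rewrite /tau_brk (sw_mulC _ _ (tau_bal_pure m)) sw_hom; last first.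
  exact: (balA_sw_mull d (tau_bal_pure m)).
transitivity (sw h (fun h1 h2 => sw d (fun x y =>
    mpure (pi x *: ((tgt H1 (eps H1 h2) * h1) *: m)) (coB y)))).
  apply: eq_sw => h1 h2.
  transitivity (sw d (fun x y =>
      mpure (pi x *: (h1 *: m)) (coB (y * src H2 (eps H1 h2))))).
    apply: eq_sw => x y; rewrite (rmorphM pi) /= pi_iota scalerA; congr mpure.
    by rewrite coB_iota; apply: cval_inj; rewrite !cval_coB prj_srcr_tgtr.
  rewrite -(sw_takeuchi _ _ (tau_bal_pure (h1 *: m))).
  by apply: eq_sw => x y; rewrite rmorphM /= bgd_tgt -!scalerA.
rewrite (sw_epsr h (F := fun w => sw d (fun x y => mpure (pi x *: (w *: m)) (coB y)))) //.
move=> w w'; rewrite -swD; apply: eq_sw => x y.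
by rewrite scalerDl scalerDr mpureDl.
Qed.

Lemma tau_brkDr d : {morph tau_brk d : m m' / m + m'}.
Proof.
by move=> m m'; rewrite /tau_brk -swD; apply: eq_sw => x y; rewrite scalerDr mpureDl.
Qed.

Lemma tau_bal : balM (fun (b : B) (m : M) => tau_brk (cval b) m).
Proof.
split=> [m b b'|b m m'|a b m].
- by rewrite /tau_brk cvalD (sw_argD _ _ (tau_bal_pure m)).
- exact: tau_brkDr.
- by rewrite cval_tgt -(bgd_src iota) tau_brk_iota.
Qed.

Definition tau (x : mtens B M) : mtens M B := mlift (fun b m => tau_brk (cval b) m) x.

Lemma tauD : {morph tau : x y / x + y}. Proof. exact: mliftD tau_bal. Qed.

Lemma tau_pure b m : tau (mpure b m) = tau_brk (cval b) m.
Proof. exact: mliftE tau_bal b m. Qed.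

Lemma tau_brkE d m : tau (brk d m) = tau_brk d m.
Proof.
rewrite /brk (sw_morph _ _ tauD) -[in RHS](prj_sw1 pi iota d) [in RHS]/tau_brk.
rewrite (sw_sw _ _ (tau_bal_pure m)); apply: eq_sw => x y.
by rewrite tau_pure cval_coB -/(tau_brk _ _) tau_brk_iota.
Qed.

Lemma tau_act h : {morph tau : x / h *: x}.
Proof.
apply: mtens_eq => [x y|x y|b m]; rewrite ?scalerDr ?tauD ?scalerDr //.
rewrite -brk_cval brk_act !tau_brkE /tau_brk.
rewrite (sw_mul _ _ (tau_bal_pure m)) sw_hom.
  rewrite (sw_morph (f := fun w => h *: w)); last exact: scalerDr.
  rewrite sw_exchange; apply: eq_sw => x y; rewrite mpure_act.
  by apply: eq_sw => h1 h2; rewrite scale_coB scalerA (rmorphM pi) /= pi_iota.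
split=> [z u v|z u v|a u v].
- by rewrite -swD; apply: eq_sw => x y; rewrite mulrDl raddfD scalerDl mpureDl.
- by rewrite -swD; apply: eq_sw => x y; rewrite mulrDl coBD mpureDr.
- by apply: eq_sw => x y; rewrite -!mulrA; case: (tau_bal_pure m) => _ _ ->.
Qed.

End Braiding.
End Coinvariants.

(** * Invertibility, naturality and the hexagon of the half-braiding *)

Section CenterObject.
Variables (K : fieldType) (A : algType K) (H2 H1 : hopf_algebroid A).
Variables (pi : bgd_hom H2 H1) (iota : bgd_hom H1 H2).
Hypothesis pi_iota : forall y : H1, pi (iota y) = y.

Local Notation prj := (prj pi iota).
Local Notation B := (coinv_mod pi_iota).
Local Notation coB := (coB pi_iota).
Local Notation brk := (brk pi_iota).
Local Notation tau_at M := (@tau K A H2 H1 pi iota pi_iota M).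
Local Notation tau_brk := (tau_brk pi_iota).

Lemma sw_mpurel (D : bialgebroid A) (M N : lmodType H1) (d : D) (F : D -> D -> M) (n : N) :
  mpure (sw d F) n = sw d (fun x y => mpure (F x y) n).
Proof. by rewrite (sw_morph (f := fun w => mpure w n)) // => ? ?; rewrite mpureDl. Qed.

Lemma sw_mpurer (D : bialgebroid A) (M N : lmodType H1) (d : D) (F : D -> D -> N) (m : M) :
  mpure m (sw d F) = sw d (fun x y => mpure m (F x y)).
Proof. by rewrite (sw_morph (f := fun w => mpure m w)) // => ? ?; rewrite mpureDr. Qed.

Section Inverse.
Variable M : lmodType H1.

Lemma brk_odot (m : M) : odot_balanced (fun x y => brk x (pi y *: m)).
Proof.
split=> [z u v|z u v|a u v].
- exact: brkDl.
- by rewrite raddfD scalerDl brkDr.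
- by rewrite -(bgd_src iota) brk_iota rmorphM /= !bgd_src scalerA.
Qed.

(* [sigma m u v] is classically [(v_(2), S^-1 (pi v_(1)) (pi u) m)]. *)
Definition sigma (m : M) (u v : H2) : mtens B M :=
  vartheta_ext (fun x y => brk x (pi y *: m)) u v.

Lemma sigma_bal m : balA (sigma m).
Proof. exact: vartheta_ext_bal (brk_odot m). Qed.

Lemma sigma_sw m x y : sw x (fun x1 x2 => sigma m (x1 * y) x2) = brk x (pi y *: m).
Proof. exact: vartheta_extE (brk_odot m). Qed.

Lemma sigmaDl u v : {morph (fun m => sigma m u v) : m m' / m + m'}.
Proof.
move=> m m'; move: u v; apply: vartheta_gen; first exact: sigma_bal.
  have [a1 a2 a3] := sigma_bal m; have [b1 b2 b3] := sigma_bal m'.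
  split=> [z u v|z u v|a u v].
  - by rewrite a1 b1 addrACA.
  - by rewrite a2 b2 addrACA.
  - by rewrite a3 b3.
by move=> x y; rewrite swD !sigma_sw scalerDr brkDr.
Qed.

Lemma sigma_mulr m y u v : sigma m (u * y) v = sigma (pi y *: m) u v.
Proof.
move: u v; apply: vartheta_gen; last first.
- move=> x z; rewrite sigma_sw; under eq_sw do rewrite -mulrA.
  by rewrite sigma_sw rmorphM scalerA.
- exact: sigma_bal.
have [b1 b2 b3] := sigma_bal m.
split=> [z u v|z u v|a u v].
- by rewrite mulrDl b1.
- by rewrite b2.
- by rewrite -mulrA b3.
Qed.

Lemma tau_inv_bal : balM (fun (m : M) (b : B) => sigma m 1 (cval b)).
Proof.
split=> [b m m'|m b b'|a m b].
- exact: sigmaDl.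
- by rewrite cvalD; case: (sigma_bal m) => _ ->.
- rewrite -(bgd_tgt pi) -sigma_mulr mul1r -[tgt H2 a]mulr1 cval_src.
  by case: (sigma_bal m) => _ _ ->.
Qed.

Definition tau_inv (x : mtens M B) : mtens B M := mlift (fun m b => sigma m 1 (cval b)) x.

Lemma tau_invD : {morph tau_inv : x y / x + y}.
Proof. exact: mliftD tau_inv_bal. Qed.

Lemma tau_inv_pure m b : tau_inv (mpure m b) = sigma m 1 (cval b).
Proof. exact: mliftE tau_inv_bal m b. Qed.

(** The composite is the sum of sigma m b_(1) (prj b_(2)); the projection drops because b is
    coinvariant, and [sigma_sw] at y = 1 returns b (x) m. *)
Lemma tauK : cancel (tau_at M) tau_inv.
Proof.
apply: (mtens_eq (F := fun x => tau_inv (tau x)) (G := id)) => [x y|//|b m].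
  by rewrite tauD tau_invD.
rewrite tau_pure (sw_morph _ _ tau_invD).
transitivity (sw (cval b) (fun x y => sigma m x (prj y))).
  apply: eq_sw => x y; rewrite tau_inv_pure cval_coB.
  by rewrite -[in RHS](mul1r x) sigma_mulr.
rewrite (sw_fixed_prj pi_iota (cval_fixed b) (sigma_bal m)).
rewrite -[RHS]brk_cval -[m in RHS]scale1r -(rmorph1 pi) -sigma_sw.
by apply: eq_sw => x y; rewrite mulr1.
Qed.

(** Only u = 1 is wanted in [tau_invK], but the generators x_(1) y (x) x_(2) of [vartheta] do not
    stay in that case. *)
Lemma tau_sigma m u v : tau (sigma m u v) = mpure (pi u *: m) (coB v).
Proof.
have [b1 b2 b3] := sigma_bal m.
move: u v; apply: vartheta_gen; [|exact: tau_bal_pure|].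
- split=> [z u v|z u v|a u v].
  + by rewrite b1 tauD.
  + by rewrite b2 tauD.
  + by rewrite b3.
- move=> x y; rewrite -(sw_morph _ _ (tauD (pi_iota := pi_iota) (M := M))) sigma_sw tau_brkE.
  by apply: eq_sw => u v; rewrite rmorphM scalerA.
Qed.

Lemma tau_invK : cancel tau_inv (tau_at M).
Proof.
apply: (mtens_eq (F := fun x => tau (tau_inv x)) (G := id)) => [x y|//|m b].
  by rewrite tau_invD tauD.
by rewrite tau_inv_pure tau_sigma rmorph1 scale1r coB_cval.
Qed.

Lemma tau_bij : bijective (tau_at M).
Proof. exact: Bijective tauK tau_invK. Qed.

Lemma tau_linear : linear (tau_at M).
Proof. by move=> h x y; rewrite tauD tau_act. Qed.

Definition tau_lin : {linear mtens B M -> mtens M B} :=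
  HB.pack (tau_at M) (GRing.isLinear.Build H1 (mtens B M) (mtens M B) *:%R (tau_at M)
    tau_linear).

End Inverse.

Lemma Abilin_tau M : Abilin (tau_at M).
Proof. exact: (Abilin_linear (tau_lin M)). Qed.

Lemma tau_nat (M N : lmodType H1) (f : {linear M -> N}) x :
  tau_at N (mmap id f x) = mmap f id (tau_at M x).
Proof.
have bf := Abilin_linear f; have bi (M' : lmodType H1) : Abilin (@id M') := Abilin_id M'.
move: x; apply: mtens_eq => [x y|x y|b m].
- by rewrite mmapD // tauD.
- by rewrite tauD mmapD.
- rewrite mmapE // !tau_pure (sw_morph _ _ (mmapD bf (bi B))).
  by apply: eq_sw => x y; rewrite mmapE // linearZ.
Qed.

Lemma tau_brk_bal (M N : lmodType H1) (m : M) (n : N) :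
  balA (fun x y => mpure (pi x *: m) (tau_brk y n)).
Proof.
split=> [z u v|z u v|a u v].
- by rewrite raddfD scalerDl mpureDl.
- by rewrite /tau_brk (sw_argD _ _ (tau_bal_pure pi_iota n)) mpureDr.
- rewrite rmorphM /= bgd_tgt -scalerA mpure_bal.
  congr mpure; rewrite -!tau_brkE -tau_act brk_act.
  by rewrite bgd_src.
Qed.

(** The hexagon is coassociativity of H2, once the projection between the two braidings is dropped
    by [sw_fixed_prj]. *)
Lemma tau_tens (M N : lmodType H1) (x : mtens (mtens B M) N) :
  massoc (tau_at (mtens M N) (massoc x)) = mmap id (tau_at N) (massoc (mmap (tau_at M) id x)).
Proof.
have bi (M' : lmodType H1) : Abilin (@id M') := Abilin_id M'.
have aD := @massocD K A H1; have tD N' := @tauD K A H2 H1 pi iota pi_iota N'.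
have bt M' := Abilin_tau M'.
have m1D := mmapD (bt M) (bi N); have m2D := mmapD (bi M) (bt N).
move: x; apply: mtens_eq3l => [||b m n].
- exact: (morphD_comp (aD _ _ _) (morphD_comp (tD _) (aD _ _ _))).
- exact: (morphD_comp m2D (morphD_comp (aD _ _ _) m1D)).
have -> : massoc (mpure (mpure b m) n) = mpure b (mpure m n) := massocE b m n.
rewrite tau_pure (mmapE (bt M) (bi N)) tau_pure sw_mpurel.
rewrite (sw_morph _ _ (aD M N B)) (sw_morph _ _ (aD M B N)) (sw_morph _ _ m2D).
transitivity (sw (cval b) (fun x y => mpure (pi x *: m) (tau_brk (prj y) n))); last first.
  apply: eq_sw => x y; rewrite massocE (mmapE (bi M) (bt N)).
  by rewrite tau_pure.
rewrite (sw_fixed_prj pi_iota (cval_fixed b) (tau_brk_bal m n)).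
pose F x y z := mpure (pi x *: m) (mpure (pi y *: n) (coB z)).
have bF : balA3 F.
  split=> [z|x]; split=> [w u v|w u v|a u v]; rewrite /F.
  - by rewrite raddfD scalerDl mpureDl.
  - by rewrite raddfD scalerDl mpureDl mpureDr.
  - by rewrite !rmorphM /= bgd_tgt bgd_src -!scalerA mpure_bal mpure_src.
  - by rewrite raddfD scalerDl mpureDl mpureDr.
  - by rewrite coBD !mpureDr.
  - by rewrite rmorphM /= bgd_tgt -scalerA mpure_bal src_coB.
transitivity (sw (cval b) (fun x y => sw y (fun y1 y2 => F x y1 y2))); last first.
  by apply: eq_sw => x y; rewrite -sw_mpurer.
rewrite -(sw_coassoc _ bF); apply: eq_sw => x y.
rewrite mpure_act sw_hom; last exact: balA_mpure.
rewrite sw_mpurel (sw_morph _ _ (aD M N B)).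
by apply: eq_sw => x1 x2; rewrite massocE.
Qed.

Lemma tau_unit x : mlunit (tau_at (munit H1) x) = mrunit x.
Proof.
move: x; apply: mtens_eq => [x y|x y|b a]; rewrite ?mrunitD ?tauD ?mlunitD //.
rewrite tau_pure mrunitE (sw_morph _ _ (@mlunitD _ _ _ _)).
rewrite -[RHS]coB_cval cval_tgt.
(* The counit law is applied to b * src a, whose coproduct carries src a on the first leg; there it
   gives the action of pi b_(1) on a. *)
rewrite -(sw_epsl _ (F := coB)); last exact: coBD.
rewrite sw_srcr; last first.
  split=> [w u v|w u v|c u v].
  - by rewrite !raddfD mulrDl coBD.
  - by rewrite mulrDr coBD.
  - by rewrite eps_tgt rmorphM mulrA.
apply: eq_sw => u v; rewrite mlunitE src_coB; congr coB.
by rewrite /GRing.scale /= /munit_act -(bgd_src pi) -rmorphM bgd_eps.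
Qed.

Definition coinv_center : center_obj H1 :=
  @CenterObj K A H1 B tau_lin tau_bij tau_nat tau_tens tau_unit.

End CenterObject.

(** * The braided Hopf algebra of coinvariants *)

Section BraidedHopf.
Variables (K : fieldType) (A : algType K) (H2 H1 : hopf_algebroid A).
Variables (pi : bgd_hom H2 H1) (iota : bgd_hom H1 H2).
Hypothesis pi_iota : forall y : H1, pi (iota y) = y.

Local Notation prj := (prj pi iota).
Local Notation ant := (ant pi iota).
Local Notation B := (coinv_mod pi_iota).
Local Notation coB := (coB pi_iota).
Local Notation brk := (brk pi_iota).

Lemma coB_iota_src x h : coB (x * iota h) = coB (x * src H2 (eps H1 h)).
Proof. by apply: cval_inj; rewrite !cval_coB prj_iota. Qed.

Lemma cval_mul (b b' : B) : cval (coB (cval b * cval b')) = cval b * cval b'.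
Proof. by rewrite cval_coB prj_fixedM ?cval_fixed. Qed.

Lemma mulB_bal : balM (fun b b' : B => coB (cval b * cval b')).
Proof.
split=> [m b b'|b m m'|a b b'].
- by rewrite cvalD mulrDl coBD.
- by rewrite cvalD mulrDr coBD.
- by rewrite cval_tgt cval_src mulrA.
Qed.

Definition mulB (x : mtens B B) : B := mlift (fun b b' => coB (cval b * cval b')) x.

Lemma mulBD : {morph mulB : x y / x + y}. Proof. exact: mliftD mulB_bal. Qed.
Lemma mulB_pure b b' : mulB (mpure b b') = coB (cval b * cval b').
Proof. exact: mliftE mulB_bal b b'. Qed.

(** The product of B extended to H2 (x)_{H1} B; in this form it visibly commutes with left
    multiplication by iota h. *)
Lemma mulB_brk d b : mulB (brk d b) = coB (d * cval b).
Proof.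
rewrite /brk (sw_morph _ _ mulBD) -[in RHS](prj_sw1 pi iota d).
rewrite (sw_morph (f := fun w => coB (w * cval b))); last first.
  by move=> x y; rewrite mulrDl coBD.
apply: eq_sw => x y; rewrite mulB_pure -{1}(coB_cval b) scale_coB !cval_coB.
by rewrite coB_mul_prj mulrA.
Qed.

Lemma mulB_linear : linear mulB.
Proof.
move=> h x y; rewrite mulBD; congr (_ + _); move: x.
apply: mtens_eq => [x x'|x x'|b b'].
- by rewrite scalerDr mulBD.
- by rewrite mulBD scalerDr.
- by rewrite -brk_cval brk_act !mulB_brk scale_coB mulrA.
Qed.

Definition mulB_lin : {linear mtens B B -> B} :=
  HB.pack mulB (GRing.isLinear.Build H1 (mtens B B) B *:%R mulB mulB_linear).

Definition unitB (a : munit H1) : B := coB (src H2 (a : A)).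

Lemma cval_unitB a : cval (unitB a) = src H2 (a : A).
Proof. by rewrite cval_coB prj_srcE. Qed.

Lemma unitB_linear : linear unitB.
Proof.
move=> h a a'; rewrite /unitB raddfD coBD; congr (_ + _).
have E : iota h * src H2 (a : A) = 1 * iota (h * src H1 (a : A)).
  by rewrite mul1r rmorphM /= bgd_src.
by rewrite scale_coB E coB_iota_src mul1r.
Qed.

Definition unitB_lin : {linear munit H1 -> B} :=
  HB.pack unitB (GRing.isLinear.Build H1 (munit H1) B *:%R unitB unitB_linear).

Lemma copB_bal : balA (fun x y => mpure (coB x) (coB y)).
Proof.
split=> [z u v|z u v|a u v].
- by rewrite coBD mpureDl.
- by rewrite coBD mpureDr.
- by rewrite -tgt_coB -src_coB mpure_bal.
Qed.

Definition cop_coB (d : H2) : mtens B B := sw d (fun x y => mpure (coB x) (coB y)).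

Lemma cop_coBD : {morph cop_coB : x y / x + y}.
Proof. by move=> x y; apply: sw_argD copB_bal. Qed.

(** The second leg sees h_(2) only through its counit; Takeuchi brings that scalar to the first leg,
    where the counit law leaves h and [coB] reduces it to eps h. Hence [cop_coB] factors through
    [prj]. *)
Lemma cop_coB_iota x h : cop_coB (x * iota h) = cop_coB (x * tgt H2 (eps H1 h)).
Proof.
rewrite /cop_coB (sw_mulC _ _ copB_bal) (sw_hom iota h (balA_sw_mull x copB_bal)).
transitivity (sw h (fun h1 h2 => sw x (fun u v =>
    mpure (coB (u * iota (tgt H1 (eps H1 h2) * h1))) (coB v)))).
  apply: eq_sw => h1 h2.
  transitivity (sw x (fun u v =>
      mpure (coB (u * iota h1)) (coB (v * src H2 (eps H1 h2))))).
    by apply: eq_sw => u v; rewrite (coB_iota_src v).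
  have b : balA (fun u v => mpure (coB (u * iota h1)) (coB v)).
    have := balA_mulrr (iota h1) 1 copB_bal; congr balA.
    by do 2!(apply/funext => ?); rewrite mulr1.
  rewrite -(sw_takeuchi _ _ b).
  by apply: eq_sw => u v; rewrite rmorphM /= bgd_tgt mulrA.
rewrite (sw_epsr h (F := fun w => sw x (fun u v => mpure (coB (u * iota w)) (coB v)))).
  rewrite (sw_tgtr _ _ copB_bal).
  transitivity (sw x (fun u v => mpure (coB (u * tgt H2 (eps H1 h))) (coB v))).
    by apply: eq_sw => u v; rewrite coB_iota.
  rewrite (sw_takeuchi _ _ copB_bal); apply: eq_sw => u v; congr mpure.
  by apply: cval_inj; rewrite !cval_coB prj_srcr_tgtr.
move=> w w'; rewrite -swD; apply: eq_sw => u v.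
by rewrite raddfD mulrDr coBD mpureDl.
Qed.

Lemma cop_coB_prj d : cop_coB (prj d) = cop_coB d.
Proof.
rewrite -[in RHS](prj_sw1 pi iota d) (sw_morph _ _ cop_coBD).
rewrite -(prj_sw_eps pi iota d cop_coBD); apply: eq_sw => u v.
by rewrite cop_coB_iota bgd_eps -(bgd_src iota) cop_coB_iota eps_srcE.
Qed.

Definition copB (b : B) : mtens B B := cop_coB (cval b).

Lemma copB_coB d : copB (coB d) = cop_coB d.
Proof. by rewrite /copB cval_coB cop_coB_prj. Qed.

Lemma copB_linear : linear copB.
Proof.
move=> h b b'; rewrite /copB cvalD cop_coBD; congr (_ + _).
rewrite -/(copB (h *: b)) scale_cval copB_coB /cop_coB.
rewrite (sw_mul _ _ copB_bal) sw_hom.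
  rewrite (sw_morph (f := fun w => h *: w)); last exact: scalerDr.
  rewrite sw_exchange; apply: eq_sw => x y; rewrite mpure_act.
  by apply: eq_sw => h1 h2; rewrite !scale_coB.
split=> [z u v|z u v|a u v].
- by rewrite -swD; apply: eq_sw => x y; rewrite mulrDl coBD mpureDl.
- by rewrite -swD; apply: eq_sw => x y; rewrite mulrDl coBD mpureDr.
- by apply: eq_sw => x y; rewrite -!mulrA; case: copB_bal => _ _ ->.
Qed.

Definition copB_lin : {linear B -> mtens B B} :=
  HB.pack copB (GRing.isLinear.Build H1 B (mtens B B) *:%R copB copB_linear).

Definition epsB (b : B) : munit H1 := eps H2 (cval b).

Lemma epsB_coB d : epsB (coB d) = eps H2 d.
Proof. by rewrite /epsB cval_coB eps_prj. Qed.

Lemma epsB_linear : linear epsB.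
Proof.
move=> h b b'; rewrite {1}/epsB cvalD raddfD; congr (_ + _).
rewrite -/(epsB (h *: b)) scale_cval epsB_coB -[LHS]eps_mul_src.
by rewrite -(bgd_src iota) -rmorphM bgd_eps.
Qed.

Definition epsB_lin : {linear B -> munit H1} :=
  HB.pack epsB (GRing.isLinear.Build H1 B (munit H1) *:%R epsB epsB_linear).

Definition antB (b : B) : B := coB (ant (cval b)).

Lemma antB_coB d : antB (coB d) = coB (ant d).
Proof. by rewrite /antB cval_coB ant_prj. Qed.

Lemma cval_antB b : cval (antB b) = ant (cval b).
Proof. by rewrite cval_coB prj_ant. Qed.

Lemma antB_linear : linear antB.
Proof.
move=> h b b'; rewrite {1}/antB cvalD antD coBD; congr (_ + _).
rewrite -/(antB (h *: b)) scale_cval antB_coB (ant_iotal pi_iota).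
by rewrite coB_prj scale_coB.
Qed.

Definition antB_lin : {linear B -> B} :=
  HB.pack antB (GRing.isLinear.Build H1 B B *:%R antB antB_linear).

End BraidedHopf.

(** * The axioms of a braided Hopf algebra for B *)

Section BraidedHopfAxioms.
Variables (K : fieldType) (A : algType K) (H2 H1 : hopf_algebroid A).
Variables (pi : bgd_hom H2 H1) (iota : bgd_hom H1 H2).
Hypothesis pi_iota : forall y : H1, pi (iota y) = y.

Local Notation prj := (prj pi iota).
Local Notation ant := (ant pi iota).
Local Notation B := (coinv_mod pi_iota).
Local Notation coB := (coB pi_iota).
Local Notation tau_at M := (@tau K A H2 H1 pi iota pi_iota M).
Local Notation tau_brk := (tau_brk pi_iota).
Local Notation mulB := (@mulB K A H2 H1 pi iota pi_iota).
Local Notation unitB := (unitB pi_iota).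
Local Notation copB := (@copB K A H2 H1 pi iota pi_iota).
Local Notation epsB := (@epsB K A H2 H1 pi iota pi_iota).
Local Notation antB := (@antB K A H2 H1 pi iota pi_iota).
Local Notation cop_coB := (cop_coB pi_iota).

Let aD (M N P : lmodType H1) : {morph @massoc K A H1 M N P : x y / x + y}.
Proof. exact: massocD. Qed.
Let aVD (M N P : lmodType H1) : {morph @massocV K A H1 M N P : x y / x + y}.
Proof. exact: massocVD. Qed.
Let tD (M : lmodType H1) : {morph tau_at M : x y / x + y}.
Proof. exact: tauD. Qed.
Let bi (M : lmodType H1) : Abilin (@id M) := Abilin_id M.
Let bt (M : lmodType H1) : Abilin (tau_at M) := Abilin_tau pi_iota M.
Let bmul : Abilin mulB := Abilin_linear (mulB_lin pi_iota).
Let bunit : Abilin unitB := Abilin_linear (unitB_lin pi_iota).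
Let bcop : Abilin copB := Abilin_linear (copB_lin pi_iota).
Let beps : Abilin epsB := Abilin_linear (epsB_lin pi_iota).
Let bant : Abilin antB := Abilin_linear (antB_lin pi_iota).

Definition tau2 : half_braiding (mtens B B) :=
  hb_tens (tau_lin pi_iota : half_braiding B) (tau_lin pi_iota : half_braiding B).

Lemma tau2D M : {morph @tau2 M : x y / x + y}.
Proof.
apply: (morphD_comp (@aD M B B) (morphD_comp (mmapD (bt M) (bi B)) _)).
exact: (morphD_comp (@aVD B M B) (morphD_comp (mmapD (bi B) (bt M)) (@aD B B M))).
Qed.

Lemma tau2_pure (M : lmodType H1) (b b' : B) (m : M) :
  tau2 (mpure (mpure b b') m) = sw (cval b') (fun x' y' =>
    massoc (mpure (tau_brk (cval b) (pi x' *: m)) (coB y'))).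
Proof.
rewrite /tau2 /hb_tens massocE (mmapE (bi B) (bt M)) tau_pure sw_mpurer.
rewrite (sw_morph _ _ (@aVD B M B)) (sw_morph _ _ (mmapD (bt M) (bi B))).
rewrite (sw_morph _ _ (@aD M B B)); apply: eq_sw => x y.
by rewrite massocVE (mmapE (bt M) (bi B)) tau_pure.
Qed.

Lemma massoc_tau_brk (M : lmodType H1) d (m : M) (b : B) :
  massoc (mpure (tau_brk d m) b) = sw d (fun x y => mpure (pi x *: m) (mpure (coB y) b)).
Proof.
rewrite sw_mpurel (sw_morph _ _ (@aD M B B)).
by apply: eq_sw => x y; rewrite massocE.
Qed.

Lemma mulB_br : hb_compat tau2 (tau_lin pi_iota : half_braiding B) (mulB_lin pi_iota).
Proof.
move=> M; apply: mtens_eq3l => [||b b' m].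
- exact: (morphD_comp (@tD M) (mmapD bmul (bi M))).
- exact: (morphD_comp (mmapD (bi M) bmul) (@tau2D M)).
rewrite (mmapE bmul (bi M)) [LHS]tau_pure tau2_pure.
rewrite (sw_morph _ _ (mmapD (bi M) bmul)).
rewrite mulB_pure cval_mul /tau_brk (sw_mulC _ _ (tau_bal_pure pi_iota m)).
apply: eq_sw => x' y'; rewrite massoc_tau_brk (sw_morph _ _ (mmapD (bi M) bmul)).
rewrite -(sw_fixed_prj pi_iota (cval_fixed b)).
  apply: eq_sw => x y; rewrite (mmapE (bi M) bmul) rmorphM scalerA.
  by rewrite mulB_pure !cval_coB coB_mul_prj.
split=> [z u v|z u v|a u v].
- by rewrite mulrDl raddfD scalerDl mpureDl.
- by rewrite mulrDl coBD mpureDr.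
- by rewrite -!mulrA rmorphM /= bgd_tgt -scalerA mpure_bal src_coB.
Qed.

Lemma unitB_br :
  hb_compat (@hb_unit K A H1) (tau_lin pi_iota : half_braiding B) (unitB_lin pi_iota).
Proof.
move=> M; apply: mtens_eq => [||a m].
- exact: (morphD_comp (@tD M) (mmapD bunit (bi M))).
- apply: (morphD_comp (mmapD (bi M) bunit)) => x y.
  by rewrite /hb_unit mlunitD [LHS]mpureDl.
rewrite (mmapE bunit (bi M)) [LHS]tau_pure /hb_unit mlunitE.
rewrite [RHS](mmapE (bi M) bunit) cval_unitB /tau_brk.
rewrite (sw_src _ (tau_bal_pure pi_iota m)) bgd_src; congr mpure.
by rewrite /= /unitB rmorph1.
Qed.

Lemma cop_coB_coassoc_bal (M : lmodType H1) (m : M) :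
  balA3 (fun x y z => mpure (pi x *: m) (mpure (coB y) (coB z))).
Proof.
split=> [z|x]; split=> [w u v|w u v|a u v].
- by rewrite raddfD scalerDl mpureDl.
- by rewrite coBD mpureDl mpureDr.
- by rewrite rmorphM /= bgd_tgt -scalerA mpure_bal mpure_src src_coB.
- by rewrite coBD mpureDl mpureDr.
- by rewrite coBD !mpureDr.
- by rewrite -tgt_coB -src_coB mpure_bal.
Qed.

Lemma copB_br : hb_compat (tau_lin pi_iota : half_braiding B) tau2 (copB_lin pi_iota).
Proof.
move=> M; apply: mtens_eq => [||b m].
- exact: (morphD_comp (@tau2D M) (mmapD bcop (bi M))).
- exact: (morphD_comp (mmapD (bi M) bcop) (@tD M)).
rewrite (mmapE bcop (bi M)) [tau_lin _ _ _]tau_pure (sw_morph _ _ (mmapD (bi M) bcop)).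
rewrite /copB /cop_coB sw_mpurel (sw_morph _ _ (@tau2D M)).
(* The braiding of x past n, with z standing by. Balancedness at both junctions lets [sw_fixed_prj]
   and coassociativity act on the three legs of b. *)
pose W x n z : mtens M (mtens B B) := massoc (mpure (tau_at M (mpure (coB x) n)) (coB z)).
have WD1 n z : {morph (fun x => W x n z) : x y / x + y}.
  by move=> x y; rewrite /W coBD mpureDl (@tD M) mpureDl; apply: (@aD M B B).
have WD2 x z : {morph (fun n => W x n z) : n n' / n + n'}.
  by move=> n n'; rewrite /W mpureDr (@tD M) mpureDl; apply: (@aD M B B).
have WD3 x n : {morph (fun z => W x n z) : z z' / z + z'}.
  by move=> z z'; rewrite /W coBD mpureDr; apply: (@aD M B B).
have Wsrc a x n z : W (tgt H2 a * x) n z = W x (src H1 a *: n) z.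
  by rewrite /W -tgt_coB mpure_bal.
have Wtgt a x n z : W x (tgt H1 a *: n) z = W x n (src H2 a * z).
  by rewrite /W -mpure_tgt tau_act mpure_bal src_coB.
have bW : balA3 (fun x u v => W x (pi u *: m) v).
  split=> [z|x]; split=> [w u v|w u v|a u v].
  - exact: WD1.
  - by rewrite raddfD scalerDl WD2.
  - by rewrite Wsrc rmorphM /= bgd_src scalerA.
  - by rewrite raddfD scalerDl WD2.
  - exact: WD3.
  - by rewrite rmorphM /= bgd_tgt -scalerA Wtgt.
have bG : balA (fun x y => sw y (fun u v => W x (pi u *: m) v)).
  case: bW => W1 W2; split=> [w u v|w u v|a u v].
  - by rewrite -swD; apply: eq_sw => x y; apply: WD1.
  - exact: sw_argD.
  - rewrite sw_srcl //; apply: eq_sw => x y.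
    by rewrite Wsrc rmorphM /= bgd_src scalerA.
transitivity (sw (cval b) (fun x y => sw (prj y) (fun u v => W x (pi u *: m) v))).
  apply: eq_sw => x y; rewrite tau2_pure; apply: eq_sw => u v.
  by rewrite /W tau_pure.
rewrite (sw_fixed_prj pi_iota (cval_fixed b) bG) -(sw_coassoc _ bW).
transitivity (sw (cval b) (fun x y => sw x (fun x1 x2 =>
    mpure (pi x1 *: m) (mpure (coB x2) (coB y))))).
  apply: eq_sw => x y; rewrite -massoc_tau_brk -tau_brkE.
  rewrite (sw_morph _ _ (@tD M)) sw_mpurel.
  by rewrite (sw_morph _ _ (@aD M B B)).
rewrite (sw_coassoc _ (cop_coB_coassoc_bal m)); apply: eq_sw => x y.
rewrite -sw_mpurer (mmapE (bi M) bcop); congr mpure.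
exact: esym (copB_coB pi_iota y).
Qed.

(** The counit collapses the second leg and leaves pi b acting on m; for a coinvariant, [pi_prj]
    turns pi b into src (eps b). *)
Lemma epsB_br :
  hb_compat (tau_lin pi_iota : half_braiding B) (@hb_unit K A H1) (epsB_lin pi_iota).
Proof.
move=> M; apply: mtens_eq => [||b m].
- apply: (morphD_comp _ (mmapD beps (bi M))) => x y.
  by rewrite /hb_unit mlunitD [LHS]mpureDl.
- exact: (morphD_comp (mmapD (bi M) beps) (@tD M)).
rewrite (mmapE beps (bi M)) [tau_lin _ _ _]tau_pure (sw_morph _ _ (mmapD (bi M) beps)).
rewrite /hb_unit mlunitE /mrunitV.
transitivity (mpure (pi (cval b) *: m) (munit1 H1)).
  by rewrite -(cval_fixed b) pi_prj // eps_prj.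
rewrite -(sw_epsr (cval b) (F := fun w => mpure (pi w *: m) (munit1 H1))); last first.
  by move=> u v; rewrite raddfD scalerDl mpureDl.
apply: eq_sw => x y; rewrite (mmapE (bi M) beps) epsB_coB.
by rewrite rmorphM /= bgd_tgt -scalerA mpure_bal munit_srcE mulr1.
Qed.

Lemma antB_br :
  hb_compat (tau_lin pi_iota : half_braiding B) (tau_lin pi_iota : half_braiding B)
    (antB_lin pi_iota).
Proof.
move=> M; apply: mtens_eq => [||b m].
- exact: (morphD_comp (@tD M) (mmapD bant (bi M))).
- exact: (morphD_comp (mmapD (bi M) bant) (@tD M)).
rewrite (mmapE bant (bi M)) [LHS]tau_pure [tau_lin _ _ _]tau_pure.
rewrite (sw_morph _ _ (mmapD (bi M) bant)) cval_antB /tau_brk.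
rewrite (ant_cop pi_iota (F := fun h d => mpure (h *: m) (coB d)) (cval_fixed b)).
  by apply: eq_sw => x y; rewrite (mmapE (bi M) bant) antB_coB.
split=> [z u v|z u v|a u v].
- by rewrite scalerDl mpureDl.
- by rewrite coBD mpureDr.
- by rewrite -scalerA mpure_bal src_coB.
Qed.

Lemma mulB_assoc x : mulB (mmap mulB id x) = mulB (mmap id mulB (massoc x)).
Proof.
have mD := @mulBD K A H2 H1 pi iota pi_iota.
move: x; apply: mtens_eq3l => [||b b' b''].
- exact: (morphD_comp mD (mmapD bmul (bi B))).
- exact: (morphD_comp mD (morphD_comp (mmapD (bi B) bmul) (@aD B B B))).
rewrite massocE (mmapE bmul (bi B)) (mmapE (bi B) bmul) !mulB_pure !cval_mul.
by rewrite mulrA.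
Qed.

Lemma mulB_unitl b : mulB (mmap unitB id (mlunitV b)) = b.
Proof.
rewrite /mlunitV (mmapE bunit (bi B)) mulB_pure cval_unitB rmorph1 mul1r.
exact: coB_cval.
Qed.

Lemma mulB_unitr b : mulB (mmap id unitB (mrunitV b)) = b.
Proof.
rewrite /mrunitV (mmapE (bi B) bunit) mulB_pure cval_unitB rmorph1 mulr1.
exact: coB_cval.
Qed.

Lemma copB_assoc b : massoc (mmap copB id (copB b)) = mmap id copB (copB b).
Proof.
rewrite {1 3}/copB /cop_coB (sw_morph _ _ (mmapD bcop (bi B))).
rewrite (sw_morph _ _ (mmapD (bi B) bcop)) (sw_morph _ _ (@aD B B B)).
transitivity (sw (cval b) (fun x y => sw x (fun x1 x2 =>
    mpure (coB x1) (mpure (coB x2) (coB y))))).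
  apply: eq_sw => x y; rewrite (mmapE bcop (bi B)).
  have -> : copB (coB x) = cop_coB x := copB_coB pi_iota x.
  rewrite sw_mpurel (sw_morph _ _ (@aD B B B)).
  by apply: eq_sw => x1 x2; rewrite massocE.
rewrite sw_coassoc.
  apply: eq_sw => x y; rewrite (mmapE (bi B) bcop) -sw_mpurer.
  by congr mpure; apply: esym (copB_coB pi_iota y).
split=> [z|x]; split=> [w u v|w u v|a u v].
- by rewrite coBD mpureDl.
- by rewrite coBD mpureDl mpureDr.
- by rewrite -tgt_coB mpure_bal mpure_src src_coB.
- by rewrite coBD mpureDl mpureDr.
- by rewrite coBD !mpureDr.
- by rewrite -tgt_coB -src_coB mpure_bal.
Qed.

Lemma copB_epsl b : mlunit (mmap epsB id (copB b)) = b.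
Proof.
rewrite /copB /cop_coB (sw_morph _ _ (mmapD beps (bi B))).
rewrite (sw_morph _ _ (@mlunitD _ _ _ B)) -[RHS]coB_cval.
rewrite -(sw_epsl (cval b) (F := coB)); last exact: coBD.
by apply: eq_sw => x y; rewrite (mmapE beps (bi B)) mlunitE epsB_coB src_coB.
Qed.

Lemma copB_epsr b : mrunit (mmap id epsB (copB b)) = b.
Proof.
rewrite /copB /cop_coB (sw_morph _ _ (mmapD (bi B) beps)).
rewrite (sw_morph _ _ (@mrunitD _ _ _ B)) -[RHS]coB_cval.
rewrite -(sw_epsr (cval b) (F := coB)); last exact: coBD.
by apply: eq_sw => x y; rewrite (mmapE (bi B) beps) mrunitE epsB_coB tgt_coB.
Qed.

Local Notation midB := (mid_braid (tau_lin pi_iota : half_braiding B)).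

Lemma inner_braid_bilin : Abilin (fun y : mtens B (mtens B B) =>
  massoc (mmap (tau_at B) id (massocV y))).
Proof.
apply: (Abilin_comp (Abilin_massoc B B B)).
apply: (Abilin_comp (Abilin_mmap (bt B) (bi B))).
exact: Abilin_massocV.
Qed.

Lemma midBD : {morph midB : x y / x + y}.
Proof.
apply: (morphD_comp (@aVD B B (mtens B B))).
exact: (morphD_comp (mmapD (bi B) inner_braid_bilin) (@aD B B (mtens B B))).
Qed.

Lemma midB_pure (b1 b2 b3 b4 : B) :
  midB (mpure (mpure b1 b2) (mpure b3 b4)) = sw (cval b2) (fun x y =>
    mpure (mpure b1 (pi x *: b3)) (mpure (coB y) b4)).
Proof.
rewrite /mid_braid massocE (mmapE (bi B) inner_braid_bilin) massocVE.
rewrite (mmapE (bt B) (bi B)) tau_pure massoc_tau_brk sw_mpurer.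
rewrite (sw_morph _ _ (@aVD B B (mtens B B))).
by apply: eq_sw => x y; rewrite massocVE.
Qed.

(** The middle braiding makes pi b_(2) act on b'_(1). By [prj_sw1], prj b_(1) * iota (pi b_(2)) is
    again a first leg of b, and the multiplicativity of the coproduct of H2 remains. *)
Lemma copB_mul x : copB (mulB x) = mmap mulB mulB (midB (mmap copB copB x)).
Proof.
have mD := @mulBD K A H2 H1 pi iota pi_iota.
have cD := raddfD (copB_lin pi_iota).
move: x; apply: mtens_eq => [||b b'].
- exact: (morphD_comp cD mD).
- exact: (morphD_comp (mmapD bmul bmul) (morphD_comp midBD (mmapD bcop bcop))).
rewrite (mmapE bcop bcop) mulB_pure copB_coB {1}/cop_coB.
rewrite (sw_mulC _ _ (copB_bal pi_iota)) /copB /cop_coB sw_mpurer.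
rewrite (sw_morph _ _ midBD) (sw_morph _ _ (mmapD bmul bmul)).
apply: eq_sw => x' y'; rewrite sw_mpurel (sw_morph _ _ midBD).
rewrite (sw_morph _ _ (mmapD bmul bmul)).
(* The summand b_(1) (pi b_(2) |> b'_(1)) (x) b_(3) b'_(2) as a function of the three legs of b. *)
pose T x u v : mtens B B := mpure (coB (prj x * iota (pi u) * x')) (coB (prj v * y')).
have bT : balA3 T.
  split=> [z|x]; split=> [w u v|w u v|a u v]; rewrite /T.
  - by rewrite prjD !mulrDl coBD mpureDl.
  - by rewrite !raddfD mulrDr mulrDl coBD mpureDl.
  - by rewrite prj_tgt !rmorphM /= !bgd_src !mulrA.
  - by rewrite !raddfD mulrDr mulrDl coBD mpureDl.
  - by rewrite prjD mulrDl coBD mpureDr.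
  - rewrite !rmorphM /= !bgd_tgt prj_src mulrA -prj_tgtC -!mulrA -tgt_coB -src_coB.
    by rewrite mpure_bal.
have bG : balA (fun x y => sw y (T x)).
  case: bT => T1 T2; split=> [w u v|w u v|a u v].
  - by rewrite -swD; apply: eq_sw => x y; case: (T1 y) => ->.
  - exact: sw_argD.
  - rewrite sw_srcl //; apply: eq_sw => x y.
    by case: (T1 y) => _ _ ->.
transitivity (sw (cval b) (fun x y => sw (prj y) (T x))); last first.
  apply: eq_sw => x y; rewrite midB_pure (sw_morph _ _ (mmapD bmul bmul)).
  apply: eq_sw => u v; rewrite (mmapE bmul bmul) !mulB_pure scale_coB !cval_coB.
  by rewrite !coB_mul_prj /T mulrA.
rewrite (sw_fixed_prj pi_iota (cval_fixed b) bG) -(sw_coassoc _ bT).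
transitivity (sw (cval b) (fun x y => mpure (coB (x * x')) (coB (prj y * y')))).
  rewrite -(sw_fixed_prj pi_iota (cval_fixed b)); last first.
    exact: (balA_mulrr x' y' (copB_bal pi_iota)).
  by [].
apply: eq_sw => x y; rewrite -[in LHS](prj_sw1 pi iota x).
rewrite (sw_morph (f := fun w => mpure (coB (w * x')) (coB (prj y * y')))) //.
by move=> u v; rewrite mulrDl coBD mpureDl.
Qed.

Lemma copB_unit a : copB (unitB a) = mmap unitB unitB (mlunitV a).
Proof.
rewrite /mlunitV (mmapE bunit bunit) copB_coB /cop_coB.
rewrite (sw_src _ (copB_bal pi_iota)) /unitB rmorph1.
(* src a and tgt a have the same projection, which lets the scalar cross the tensor sign. *)
have E : coB (src H2 (a : A)) = tgt H1 (a : A) *: coB 1.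
  rewrite tgt_coB mulr1 -[src H2 _]mul1r -[tgt H2 _]mul1r.
  by apply: cval_inj; rewrite !cval_coB prj_srcr_tgtr.
by rewrite {1}E mpure_bal src_coB mulr1.
Qed.

Lemma epsB_mul x : epsB (mulB x) = mlunit (mmap epsB epsB x).
Proof.
have mD := @mulBD K A H2 H1 pi iota pi_iota.
have eD := raddfD (epsB_lin pi_iota).
move: x; apply: mtens_eq => [||b b'].
- exact: (morphD_comp eD mD).
- exact: (morphD_comp (@mlunitD _ _ _ _) (mmapD beps beps)).
rewrite (mmapE beps beps) mlunitE munit_srcE mulB_pure epsB_coB.
exact: (eps_fixedM _ (cval_fixed b)).
Qed.

Lemma epsB_unit a : epsB (unitB a) = a.
Proof. by rewrite epsB_coB eps_srcE. Qed.

Lemma antB_l b : mulB (mmap antB id (copB b)) = unitB (epsB b).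
Proof.
have mD := @mulBD K A H2 H1 pi iota pi_iota.
rewrite /copB /cop_coB (sw_morph _ _ (mmapD bant (bi B))) (sw_morph _ _ mD).
transitivity (sw (cval b) (fun x y => coB (ant x * prj y))).
  apply: eq_sw => x y; rewrite (mmapE bant (bi B)) mulB_pure antB_coB !cval_coB.
  by rewrite prj_ant.
have bF : balA (fun x y => coB (ant x * y)).
  have [b1 b2 b3] := ant_bal1 pi iota.
  split=> [z u v|z u v|a u v].
  - by rewrite b1 coBD.
  - by rewrite b2 coBD.
  - by rewrite b3.
rewrite (sw_fixed_prj pi_iota (cval_fixed b) bF) -(sw_morph _ _ (coBD pi_iota)).
by have := pi_prj pi_iota (cval b); rewrite cval_fixed ant_sw1 => ->; rewrite bgd_src.
Qed.

Lemma antB_r b : mulB (mmap id antB (copB b)) = unitB (epsB b).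
Proof.
have mD := @mulBD K A H2 H1 pi iota pi_iota.
rewrite /copB /cop_coB (sw_morph _ _ (mmapD (bi B) bant)) (sw_morph _ _ mD).
rewrite /unitB -(prj_ant_sw pi iota) (sw_morph _ _ (coBD pi_iota)).
apply: eq_sw => x y; rewrite (mmapE (bi B) bant) mulB_pure antB_coB !cval_coB.
by rewrite prj_ant.
Qed.

Definition coinv_hopf : braided_hopf H1 :=
  @BraidedHopf K A H1 (coinv_center pi_iota)
    (mulB_lin pi_iota) (unitB_lin pi_iota) (copB_lin pi_iota) (epsB_lin pi_iota)
    (antB_lin pi_iota)
    mulB_br unitB_br copB_br epsB_br
    antB_br mulB_assoc mulB_unitl mulB_unitr
    copB_assoc copB_epsl copB_epsr copB_mul copB_unit epsB_mul epsB_unit antB_l antB_r.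

End BraidedHopfAxioms.

(** * The biproduct *)

Section Biproduct.
Variables (K : fieldType) (A : algType K) (H2 H1 : hopf_algebroid A).
Variables (pi : bgd_hom H2 H1) (iota : bgd_hom H1 H2).
Hypothesis pi_iota : forall y : H1, pi (iota y) = y.

Local Notation prj := (prj pi iota).
Local Notation B := (coinv_mod pi_iota).
Local Notation coB := (coB pi_iota).
Local Notation brk := (brk pi_iota).
Local Notation HR := (H1^o : lmodType H1).

Lemma biprod_bal : balM (fun (b : B) (h : HR) => cval b * iota (h : H1)).
Proof.
split=> [h b b'|b h h'|a b h].
- by rewrite cvalD mulrDl.
- by rewrite raddfD mulrDr.
- by rewrite cval_tgt -mulrA -(bgd_src iota) -rmorphM.
Qed.

Definition biprod (x : mtens B HR) : H2 :=
  mlift (fun (b : B) (h : HR) => cval b * iota (h : H1)) x.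

Lemma biprodD : {morph biprod : x y / x + y}.
Proof. exact: mliftD biprod_bal. Qed.

Lemma biprod_pure b (h : H1) : biprod (hpure b h) = cval b * iota h.
Proof. exact: mliftE biprod_bal b h. Qed.

Lemma biprod_zmod_morphism : zmod_morphism biprod.
Proof.
move=> x y; apply: (addIr (biprod y)).
by rewrite -biprodD !subrK.
Qed.

Definition biprod_add : {additive mtens B HR -> H2} :=
  HB.pack biprod (GRing.isZmodMorphism.Build (mtens B HR) H2 biprod biprod_zmod_morphism).

(** The case M = H1 of H2 (x)_{H1} M, which is H2 itself; the inverse of [biprod] is d |-> d (x)
    1. *)
Lemma biprod_brk d (h : H1) : biprod (brk d (h : HR)) = d * iota h.
Proof.
rewrite /brk (sw_morph _ _ biprodD) -(prj_sw pi_iota).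
by apply: eq_sw => x y; rewrite [LHS]biprod_pure cval_coB.
Qed.

Lemma biprodK : cancel biprod (fun d => brk d (1 : HR)).
Proof.
apply: (mtens_eq (F := fun x => brk (biprod x) (1 : HR)) (G := id)) => [x y|//|b h].
  by rewrite biprodD brkDl.
by rewrite [biprod _]biprod_pure brk_iota brk_cval [_ *: _]mulr1.
Qed.

Lemma biprod_bij : bijective biprod.
Proof.
exists (fun d => brk d (1 : HR)); first exact: biprodK.
by move=> d; rewrite biprod_brk rmorph1 mulr1.
Qed.

Lemma biprod_bimod (a1 a2 a3 a4 : A) (b : B) (h : H1) :
  src H2 a1 * tgt H2 a2 * biprod (hpure b h) * src H2 a3 * tgt H2 a4
    = biprod (hpure (src H1 a1 *: b) (tgt H1 a2 * h * src H1 a3 * tgt H1 a4)).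
Proof.
rewrite !biprod_pure cval_src !rmorphM /= !bgd_tgt bgd_src -!mulrA; congr (_ * _).
by rewrite !mulrA (fixed_tgtC _ (cval_fixed b)).
Qed.

Lemma biprod_one : 1 = biprod (hpure (bh_unit (coinv_hopf pi_iota) (munit1 H1)) 1).
Proof. by rewrite biprod_pure [cval _]cval_unitB !rmorph1 mulr1. Qed.

(** The smash product relation (h_(1) |> b) h_(2) = h b in H2, obtained by computing the action of h
    on b (x) k both through the coproduct and as left multiplication. *)
Lemma act_sw h (b : B) (k : H1) :
  sw h (fun h1 h2 => cval (h1 *: b) * iota (h2 * k)) = iota h * cval b * iota k.
Proof.
rewrite -biprod_brk -brk_act brk_cval mpure_act (sw_morph _ _ biprodD).
by apply: eq_sw => h1 h2; rewrite [RHS]biprod_pure.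
Qed.

Lemma biprod_mul (b b' : B) (h h' : H1) :
  biprod (hpure b h) * biprod (hpure b' h')
    = biprod (tlift (fun h1 h2 =>
        hpure (bh_mul (coinv_hopf pi_iota) (mpure b (h1 *: b'))) (h2 * h')) (cop H1 h)).
Proof.
have bF : balA (fun h1 h2 : H1 => hpure (mulB (mpure b (h1 *: b'))) (h2 * h')).
  split=> [z x y|z x y|a x y].
  - by rewrite scalerDl mpureDr mulBD [LHS]mpureDl.
  - by rewrite mulrDl [LHS]mpureDr.
  - rewrite -scalerA -mpure_tgt.
    have [_ _ mt] := Abilin_linear (mulB_lin pi_iota).
    have -> : mulB (tgt H1 a *: mpure b (x *: b')) = tgt H1 a *: mulB (mpure b (x *: b')).
      exact: mt.
    by rewrite [LHS]mpure_bal -mulrA.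
rewrite -(swE _ bF) (sw_morph _ _ biprodD).
transitivity (cval b * sw h (fun h1 h2 => cval (h1 *: b') * iota (h2 * h'))).
  by rewrite act_sw !biprod_pure !mulrA.
rewrite (sw_morph (f := fun w => cval b * w)); last exact: mulrDr.
by apply: eq_sw => h1 h2; rewrite biprod_pure mulB_pure cval_mul mulrA.
Qed.

(** As for the product of B, the coaction of the second leg supplies iota (pi b_(2)), which
    recombines with prj b_(1) to the first leg of b in H2. *)
Lemma biprod_cop (b : B) (h : H1) :
  cop H2 (biprod (hpure b h))
    = tlift (fun b1 b2 => tlift (fun h1 h2 => tlift (fun k b0 =>
          dpure (biprod (hpure b1 (k * h1))) (biprod (hpure b0 h2)))
        (coaction (b2 : coinv_hopf pi_iota))) (cop H1 h)) (bh_cop (coinv_hopf pi_iota) b).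
Proof.
pose T h1 h2 x u v : dtens H2 := tpure (prj x * iota (pi u) * iota h1) (v * iota h2).
have bT h1 h2 : balA3 (T h1 h2).
  split=> [z|x]; split=> [w u v|w u v|a u v]; rewrite /T.
  - by rewrite prjD !mulrDl tpureDl.
  - by rewrite !raddfD mulrDr mulrDl tpureDl.
  - by rewrite prj_tgt !rmorphM /= !bgd_src !mulrA.
  - by rewrite !raddfD mulrDr mulrDl tpureDl.
  - by rewrite mulrDl tpureDr.
  - by rewrite !rmorphM /= !bgd_tgt mulrA -prj_tgtC -!mulrA dtens_bal.
pose R (b1 b2 : B) h1 h2 : dtens H2 := sw (cval b2) (T h1 h2 (cval b1)).
have RE (b1 b2 : B) h1 h2 : tlift (fun k b0 =>
    dpure (biprod (hpure b1 (k * h1))) (biprod (hpure b0 h2)))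
    (coaction (b2 : coinv_hopf pi_iota)) = R b1 b2 h1 h2.
  pose F (k : HR) (b0 : B) : dtens H2 :=
    dpure (cval b1 * iota ((k : H1) * h1)) (cval b0 * iota h2).
  have bF : balM F.
    split=> [z u v|z u v|a u v]; rewrite /F /dpure.
    - by rewrite mulrDl raddfD mulrDr tpureDl.
    - by rewrite cvalD mulrDl tpureDr.
    - have -> : ((tgt H1 a *: u : HR) : H1) = tgt H1 a * u by [].
      rewrite cval_src -(mulrA (tgt H1 a)) rmorphM /= bgd_tgt mulrA.
      by rewrite -(fixed_tgtC _ (cval_fixed b1)) -!mulrA dtens_bal.
  transitivity (mlift F (coaction (b2 : coinv_hopf pi_iota))).
    rewrite /mlift; congr (tlift _ _); apply/funext => k; apply/funext => b0.
    by rewrite !biprod_pure.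
  rewrite /coaction [cen_br _ _ _]tau_pure (sw_morph _ _ (mliftD bF)).
  rewrite -[RHS](sw_fixed_prj pi_iota (cval_fixed b2)); last by case: (bT h1 h2) => _; apply.
  apply: eq_sw => x y; rewrite (mliftE bF) /F /T cval_coB cval_fixed.
  by rewrite [_ *: _]mulr1 rmorphM mulrA.
have bR b1 b2 : balA (R b1 b2).
  split=> [z u v|z u v|a u v].
  - by rewrite -swD; apply: eq_sw => x y; rewrite /T raddfD mulrDr tpureDl.
  - by rewrite -swD; apply: eq_sw => x y; rewrite /T raddfD mulrDr tpureDr.
  (* Moving a from h_(1) to h_(2) requires it to cross the whole coproduct of b2, hence the Takeuchi
     condition for b2. *)
  - pose F0 x y : dtens H2 := tpure (prj (cval b1) * (iota (pi x) * iota u)) (y * iota v).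
    have bF0 : balA F0.
      split=> [z s t|z s t|c s t]; rewrite /F0.
      + by rewrite !raddfD mulrDl mulrDr tpureDl.
      + by rewrite mulrDl tpureDr.
      + by rewrite !rmorphM /= !bgd_tgt !mulrA -prj_tgtC -!mulrA dtens_bal.
    apply: etrans (etrans _ (sw_takeuchi a (cval b2) bF0)) _; apply: eq_sw => x y.
      by rewrite /F0 /T !rmorphM /= !bgd_tgt !mulrA.
    by rewrite /F0 /T !rmorphM /= !bgd_src !mulrA.
have bM : balM (fun b1 b2 : B => sw h (R b1 b2)).
  split=> [b2 u v|b1 u v|a u v].
  - rewrite -swD; apply: eq_sw => h1 h2; rewrite -swD; apply: eq_sw => x y.
    by rewrite /T cvalD prjD !mulrDl tpureDl.
  - rewrite -swD; apply: eq_sw => h1 h2; rewrite /R cvalD.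
    by apply: sw_argD; case: (bT h1 h2).
  - apply: eq_sw => h1 h2; rewrite /R cval_src sw_srcl; last by case: (bT h1 h2) => _; apply.
    apply: eq_sw => x y; rewrite /T !cval_fixed cval_tgt.
    by rewrite !rmorphM /= !bgd_src !mulrA.
transitivity (mlift (fun b1 b2 : B => sw h (R b1 b2)) (copB b)); last first.
  rewrite /mlift; congr (tlift _ _); apply/funext => b1; apply/funext => b2.
  rewrite (swE _ (bR b1 b2)); congr (tlift _ _).
  by apply/funext => h1; apply/funext => h2; rewrite RE.
rewrite /copB /cop_coB (sw_morph _ _ (mliftD bM)).
transitivity (sw h (fun h1 h2 => sw (cval b) (fun x y => sw (prj y) (T h1 h2 x)))); last first.
  rewrite sw_exchange; apply: eq_sw => x y; rewrite (mliftE bM).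
  apply: eq_sw => h1 h2; rewrite /R !cval_coB; apply: eq_sw => u v.
  by rewrite /T prj_idem.
rewrite [biprod _]biprod_pure cop_sw.
rewrite (sw_mulC _ _ (balanced_tpure _ _)) sw_hom; last first.
  exact: (balA_sw_mull (cval b) (balanced_tpure _ _)).
apply: eq_sw => h1 h2; have [T1 T2] := bT h1 h2.
rewrite (sw_fixed_prj (F := fun x y => sw y (T h1 h2 x)) pi_iota (cval_fixed b)); last first.
  split=> [w u v|w u v|a u v].
  - by rewrite -swD; apply: eq_sw => x y; case: (T1 y) => ->.
  - exact: sw_argD.
  - by rewrite sw_srcl //; apply: eq_sw => x y; case: (T1 y) => _ _ ->.
rewrite -(sw_coassoc _ (bT h1 h2)); apply: eq_sw => x y.
rewrite -[in LHS](prj_sw1 pi iota x).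
rewrite (sw_morph (f := fun w => tpure (w * iota h1) (y * iota h2) : dtens H2)) //.
by move=> u v; rewrite mulrDl tpureDl.
Qed.

Lemma biprod_eps (b : B) (h : H1) :
  eps H2 (biprod (hpure b h)) = (bh_eps (coinv_hopf pi_iota) b : A) * eps H1 h.
Proof.
by rewrite biprod_pure (eps_fixedM _ (cval_fixed b)) bgd_eps.
Qed.

Definition coinv_biproduct : biproduct (coinv_hopf pi_iota) :=
  @Biproduct K A H1 (coinv_hopf pi_iota) H2 biprod_add biprod_bij biprod_bimod biprod_one
    biprod_mul biprod_cop biprod_eps.

End Biproduct.

Definition bgd_iso_refl (K : fieldType) (A : algType K) (D : bialgebroid A) : bgd_iso D D :=
  @BgdIso K A D D (bgd_id D) (bgd_id D) (fun=> erefl) (fun=> erefl).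

Theorem mainTheorem10 (K : fieldType) (A : algType K) (H1 H2 : hopf_algebroid A)
    (pi : bgd_hom H2 H1) (iota : bgd_hom H1 H2)
    (pi_surj : forall y : H1, exists x : H2, pi x = y)
    (iota_inj : injective iota)
    (pi_iota : forall y : H1, pi (iota y) = y) :
  exists (B : braided_hopf H1) (X : biproduct B) (Phi : bgd_iso X H2),
    injective (fun b : B => Phi (bp_inj X (hpure b 1)))
    /\ (forall x : H2,
          (exists b : B, Phi (bp_inj X (hpure b 1)) = x)
          <-> (exists h : H2, split_proj pi iota h x)).
Proof.
exists (coinv_hopf pi_iota), (coinv_biproduct pi_iota), (bgd_iso_refl H2).
have E (b : coinv_hopf pi_iota) :
    bgd_iso_refl H2 (bp_inj (coinv_biproduct pi_iota) (hpure b 1)) = cval b.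
  by apply: etrans (biprod_pure _ _) _; rewrite rmorph1 mulr1.
split=> [b b'|x]; first by rewrite !E; apply: cval_inj.
split=> [[b <-]|[h [z zh ->]]].
  (* A coinvariant is its own projection, so b itself serves as h. *)
  exists (cval b); exists (beta_inv (dpure (cval b) 1)); first exact: beta_invK.
  by rewrite E -[LHS]cval_fixed.
(* Injectivity of [beta] makes z unique, so the graph [split_proj] is the function [prj]. *)
have -> : z = beta_inv (dpure h 1) := canRL (@betaK _ _ _) zh.
by exists (coB pi_iota h); apply: E.
Qed.
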